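(* Let $U\subseteq\mathbb{R}^d$ be open and convex, and let $f:U\to\mathbb{R}$ be properly convex. Then $f$ can be approximated by strongly convex real analytic functions in the $C^0$-fine topology; that is, for every continuous function $\varepsilon:U\to(0,\infty)$ there exists a strongly convex real analytic function $g:U\to\mathbb{R}$ such that $|f(x)-g(x)|\leq\varepsilon(x)$ for all $x\in U$.
   Context: $f:U\to\mathbb{R}$ is properly convex if $f=\ell+c$, where $\ell$ is linear and $c:U\to[a,b)$, with $-\infty<a<b\leq\infty$, is convex and proper, meaning that $c^{-1}([a,\beta])$ is compact for every $\beta\in[a,b)$. A $C^2$ function on $U$ is strongly convex if its second derivative along every nonconstant straight line is strictly positive at every point of $U$. *)

(* Defs.v *)
From mathcomp Require Export all_boot all_order all_algebra finmap.
From mathcomp Require Export all_classical all_reals all_analysis.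
From mathcomp Require summability.

Set Implicit Arguments.
Unset Strict Implicit.
Unset Printing Implicit Defensive.

Import Order.TTheory GRing.Theory Num.Theory.
Import numFieldNormedType.Exports.

Local Open Scope classical_set_scope.
Local Open Scope ring_scope.

(* Functions on an open set U of R^d are total functions 'rV[R]_d -> R, of
   which only the values on U matter. *)

(* The sublevel sets are taken inside U, and compactness is the same in U and
   in 'rV[R]_d. *)
Definition proper_on (R : realType) (d : nat) (U : set 'rV[R]_d)
    (a : R) (b : \bar R) (c : 'rV[R]_d -> R) : Prop :=
  (forall x, U x -> a <= c x /\ ((c x)%:E < b)%E) /\
  (forall beta : R, a <= beta -> (beta%:E < b)%E ->
     compact [set x | U x /\ a <= c x <= beta]).

Definition properly_convex (R : realType) (d : nat) (U : set 'rV[R]_d)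
    (f : 'rV[R]_d -> R) : Prop :=
  exists (l : {scalar 'rV[R]_d}) (c : 'rV[R]_d -> R) (a : R) (b : \bar R),
    [/\ (a%:E < b)%E, convex_function U c, proper_on U a b c &
        forall x, U x -> f x = l x + c x].

(* Class C^n: all partial derivatives up to order n exist and are continuous
   on U. *)
Fixpoint continuously_differentiable (R : realType) (d : nat)
    (U : set 'rV[R]_d) (n : nat) (g : 'rV[R]_d -> R) : Prop :=
  {within U, continuous g} /\
  (if n is m.+1 then
     forall i : 'I_d,
       (forall x, U x -> derivable g x (delta_mx 0 i)) /\
       continuously_differentiable U m ('D_(delta_mx 0 i) g)
   else True).

Definition strongly_convex (R : realType) (d : nat) (U : set 'rV[R]_d)
    (g : 'rV[R]_d -> R) : Prop :=
  continuously_differentiable U 2 g /\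
  (forall (x v : 'rV[R]_d) (t : R), v != 0 -> U (x + t *: v) ->
     0 < derive1n 2 (fun s : R => g (x + s *: v)) t).

(* Unordered summation: the finite partial sums converge to s along the
   directed set of finite subsets of I. For real families this amounts to
   absolute convergence. *)
Definition has_sum (R : realType) (I : choiceType) (u : I -> R) (s : R) :
    Prop :=
  summability.partial_sum u @ @summability.totally I --> s.

Definition monomial (R : realType) (d : nat) (alpha : {ffun 'I_d -> nat})
    (x : 'rV[R]_d) : R :=
  \prod_(i < d) x 0 i ^+ alpha i.

Definition real_analytic (R : realType) (d : nat) (U : set 'rV[R]_d)
    (g : 'rV[R]_d -> R) : Prop :=
  forall p, U p -> exists k : {ffun 'I_d -> nat} -> R,
    \forall x \near p,
      has_sum (fun alpha => k alpha * monomial alpha (x - p)) (g x).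

(* Main.v *)
Require Import Defs.
From mathcomp Require Import all_boot all_order all_algebra finmap.
From mathcomp Require Import all_classical all_reals all_analysis.
From mathcomp Require Import lra ring.
From mathcomp Require summability.
Import Order.TTheory GRing.Theory Num.Theory.
Import numFieldNormedType.Exports.
Set Implicit Arguments.
Unset Strict Implicit.
Unset Printing Implicit Defensive.
Local Open Scope classical_set_scope.
Local Open Scope ring_scope.

(* Write f = l + c with c proper. There are affine functions m_i such that
   every x has some m_i(x) > c(x), each m_i stays below c + eps by a positive
   margin on all of U, and m_i <= c + s for all but finitely many i, for every
   s > 0. Choosing rates lam_i growing fast enough, define g(x) as the unique t
   with
     sum_i exp (lam_i (m_i(x) - t)) = 1.
   The margins make this sum at most 1 at t = c(x) + eps(x), and since
   m_i(x) > c(x) for some i, c < g <= c + eps. The left-hand side is a sum of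
   exponentials of functions affine in (x, t), which forces g to be convex, and
   strongly convex because properness prevents the slopes of the m_i from
   agreeing in any direction. Near each point the sum converges geometrically,
   so the equation can be solved by a contraction in a weighted l^1 algebra of
   power series, which makes g analytic. *)

(** * Unordered sums *)

(* With one common rate the equation would give the log-sum-exp smoothing of the maximum of the m_i,
   whose error cannot be tuned from place to place. Since [eps] may decay towards the boundary of U
   or at infinity, the rates have to vary with i, and g is then only given implicitly. The margin of
   each m_i is a constant over all of U, so a single finite rate serves it everywhere; properness
   produces such margins, because [eps] has a positive minimum on every compact sublevel set of c.
   The bound m_i <= c + s for late i has two uses: the maximum of the m_i(x) is attained, so that
   g(x) can be placed strictly above it, and, holding on a whole ball around a point, it limits the
   slopes of the late m_i there. This leaves room to perturb the exponents without losing
   summability, which is what the contraction for power series requires. *)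
#[local] Existing Instance summability.totally_filter.

Section has_sum_theory.
Context {R : realType}.
Implicit Types I J : choiceType.

Lemma partial_sumE I (u : I -> R) (A : {fset I}) :
  summability.partial_sum u A = \sum_(i <- A) u i.
Proof. by rewrite /summability.partial_sum big_seq_fsetE. Qed.

Lemma has_sumP I (u : I -> R) (s : R) :
  has_sum u s <->
  forall e : R, 0 < e -> exists A : {fset I}, forall B : {fset I},
    (A `<=` B)%fset -> `|\sum_(i <- B) u i - s| <= e.
Proof.
split.
  move=> us e e0.
  have [A _ AB] : summability.totally
      [set B : {fset I} | `|summability.partial_sum u B - s| < e].
    move/cvgrPdist_lt : us => /(_ e e0).
    by under eq_near do rewrite distrC.
  by exists A => B /AB /=; rewrite partial_sumE => /ltW.
move=> H; apply/cvgrPdist_le => e e0.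
have [A AB] := H e e0; exists A => // B /= /AB.
by rewrite partial_sumE distrC.
Qed.

Lemma eq_has_sum I (u v : I -> R) (s : R) : u =1 v -> has_sum u s -> has_sum v s.
Proof. by move=> /funext ->. Qed.

Lemma has_sum_unique I (u : I -> R) (s t : R) : has_sum u s -> has_sum u t -> s = t.
Proof.
move=> us ut; apply: (@cvg_unique _ (@norm_hausdorff _ _) (summability.partial_sum u @ summability.totally)) => //.
Qed.

Lemma has_sum_le I (u v : I -> R) (s t : R) : (forall i, u i <= v i) ->
  has_sum u s -> has_sum v t -> s <= t.
Proof.
move=> uv /has_sumP us /has_sumP vt; apply/ler_addgt0Pr => e e0.
have e20 : 0 < e / 2 by rewrite divr_gt0.
have [A HA] := us _ e20; have [B HB] := vt _ e20.
have := HA (A `|` B)%fset (fsubsetUl _ _).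
have := HB (A `|` B)%fset (fsubsetUr _ _).
have : \sum_(i <- (A `|` B)%fset) u i <= \sum_(i <- (A `|` B)%fset) v i.
  exact: ler_sum.
rewrite !ler_norml => ? /andP[? ?] /andP[? ?]; lra.
Qed.

Lemma has_sumD I (u v : I -> R) (s t : R) : has_sum u s -> has_sum v t ->
  has_sum (fun i => u i + v i) (s + t).
Proof.
move=> us vt; rewrite /has_sum.
rewrite [X in X @ _](_ : _ = fun A => summability.partial_sum u A + summability.partial_sum v A); last first.
  by apply/funext => A; rewrite /summability.partial_sum big_split.
exact: cvgD.
Qed.

Lemma has_sumZ I (k : R) (u : I -> R) (s : R) : has_sum u s ->
  has_sum (fun i => k * u i) (k * s).
Proof.
move=> us; rewrite /has_sum.
rewrite [X in X @ _](_ : _ = fun A => k * summability.partial_sum u A); last first.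
  by apply/funext => A; rewrite /summability.partial_sum mulr_sumr.
by apply: cvgM => //; exact: cvg_cst.
Qed.

Arguments has_sumZ {I} k {u s}.

Lemma has_sumB I (u v : I -> R) (s t : R) : has_sum u s -> has_sum v t ->
  has_sum (fun i => u i - v i) (s - t).
Proof.
move=> us vt; have := has_sumD us (has_sumZ (-1) vt).
by under eq_fun do rewrite mulN1r; rewrite mulN1r.
Qed.

Lemma has_sum0 I : has_sum (fun _ : I => 0 : R) 0.
Proof.
apply/has_sumP => e e0; exists fset0 => B _.
by rewrite big1// subrr normr0 ltW.
Qed.

Lemma has_sum_single I (i : I) (x : R) : has_sum (fun j => if j == i then x else 0) x.
Proof.
apply/has_sumP => e e0; exists [fset i]%fset => B; rewrite fsub1set => iB.
rewrite (big_fsetD1 i)//= eqxx big1_seq ?addr0 ?subrr ?normr0 ?ltW//.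
by move=> j /=; rewrite !inE => /andP[/negbTE ->].
Qed.

(** The explicit bound [C], rather than mere summability, is carried along because it later serves
    as a norm in the contraction argument. *)
Definition abs_bounded I (u : I -> R) (C : R) :=
  forall A : {fset I}, \sum_(i <- A) `|u i| <= C.

Lemma abs_bounded_ge0 I (u : I -> R) C : abs_bounded u C -> 0 <= C.
Proof. by move/(_ fset0); rewrite big_seq_fset0. Qed.

Lemma abs_bounded_term I (u : I -> R) C i : abs_bounded u C -> `|u i| <= C.
Proof. by move/(_ [fset i]%fset); rewrite big_seq_fset1. Qed.

Lemma abs_boundedW I (u v : I -> R) C D : (forall i, `|v i| <= `|u i|) -> C <= D ->
  abs_bounded u C -> abs_bounded v D.
Proof.
by move=> vu CD uC A; apply: le_trans CD; apply: le_trans (uC A); apply: ler_sum.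
Qed.

Lemma abs_boundedZ I (u : I -> R) C k : abs_bounded u C ->
  abs_bounded (fun i => k * u i) (`|k| * C).
Proof.
move=> uC A; under eq_bigr do rewrite normrM.
by rewrite -mulr_sumr ler_wpM2l.
Qed.

Lemma abs_boundedD I (u v : I -> R) C D : abs_bounded u C -> abs_bounded v D ->
  abs_bounded (fun i => u i + v i) (C + D).
Proof.
move=> uC vD A; apply: (@le_trans _ _ (\sum_(i <- A) (`|u i| + `|v i|))).
  by apply: ler_sum => i _; exact: ler_normD.
by rewrite big_split/= lerD.
Qed.

Lemma ler_sum_fset I (u : I -> R) (A B : {fset I}) : (forall i, 0 <= u i) ->
  (A `<=` B)%fset -> \sum_(i <- A) u i <= \sum_(i <- B) u i.
Proof.
move=> u0 /fsubsetP AB; rewrite [leRHS](big_fsetID _ (mem A))/=.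
have -> : [fset x in B | x \in A]%fset = A.
  apply/fsetP => x; rewrite !inE/= andbC.
  by case: (boolP (x \in A)) => //= /AB.
by rewrite lerDl sumr_ge0.
Qed.

Lemma nneg_has_sum_ex I (u : I -> R) C : (forall i, 0 <= u i) -> abs_bounded u C ->
  exists s, has_sum u s.
Proof.
move=> u0 uC; pose S := [set x | exists A : {fset I}, x = \sum_(i <- A) u i].
have hS : has_sup S.
  split; first by exists (\sum_(i <- fset0) u i), fset0.
  exists C => _ [A ->]; apply: le_trans (uC A); apply: ler_sum => i _.
  exact: ler_norm.
exists (sup S); apply/has_sumP => e e0.
have [_ [A ->] Ae] := sup_adherent e0 hS.
exists A => B AB.
have BS : \sum_(i <- B) u i <= sup S by apply: ub_le_sup; [case: hS | exists B].
have AB' : \sum_(i <- A) u i <= \sum_(i <- B) u i.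
  exact: ler_sum_fset.
rewrite ler_norml; lra.
Qed.

Lemma abs_bounded_has_sum I (u : I -> R) C : abs_bounded u C ->
  exists s, has_sum u s.
Proof.
move=> uC.
(* Both u + |u| and |u| are nonnegative with bounded partial sums, and u is their difference. *)
have [s1 h1] : exists s, has_sum (fun i => u i + `|u i|) s.
  apply: (@nneg_has_sum_ex _ _ (C + C)).
    by move=> i; have := ler_norm (- u i); rewrite normrN; lra.
  apply: abs_boundedD => //; apply: abs_boundedW uC => // i; by rewrite normr_id.
have [s2 h2] : exists s, has_sum (fun i => `|u i|) s.
  apply: (@nneg_has_sum_ex _ _ C) => //.
  apply: abs_boundedW uC => // i; by rewrite normr_id.
exists (s1 - s2); have := has_sumB h1 h2.
by under eq_fun do rewrite addrK.
Qed.

Lemma has_sum_norm_le I (u : I -> R) C s : abs_bounded u C -> has_sum u s -> `|s| <= C.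
Proof.
move=> uC /has_sumP us; apply/ler_addgt0Pr => e e0.
have [A /(_ A (fsubset_refl _)) H] := us e e0.
have := le_trans (ler_norm_sum _ _ _) (uC A).
move=> h; rewrite -[s](subKr (\sum_(i <- A) u i)).
by rewrite (le_trans (ler_normB _ _))// lerD.
Qed.

Lemma has_sum_abs_bounded I (u : I -> R) s : (forall i, 0 <= u i) ->
  has_sum u s -> abs_bounded u s.
Proof.
move=> u0 /has_sumP us A; apply/ler_addgt0Pr => e e0.
have [B /(_ (A `|` B)%fset (fsubsetUr _ _))] := us e e0.
rewrite ler_norml => /andP[_]; rewrite lerBlDl => h.
apply: le_trans h.
rewrite (eq_bigr u) => [|i _]; last by rewrite ger0_norm.
by apply: ler_sum_fset => //; exact: fsubsetUl.
Qed.

Lemma has_sum_sum I (K : Type) (r : seq K) (u : K -> I -> R) (s : K -> R) :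
  (forall k, has_sum (u k) (s k)) ->
  has_sum (fun i => \sum_(k <- r) u k i) (\sum_(k <- r) s k).
Proof.
move=> us; elim: r => [|k r IH].
  by rewrite big_nil; under eq_fun do rewrite big_nil; exact: has_sum0.
rewrite big_cons; under eq_fun do rewrite big_cons.
exact: has_sumD.
Qed.

Lemma big_fset_prod I J (A : {fset I}) (B : {fset J}) (a : I * J -> R) :
  \sum_(p <- (A `*` B)%fset) a p = \sum_(i <- A) \sum_(j <- B) a (i, j).
Proof.
transitivity (\sum_(p <- [seq (i, j) | i <- A, j <- B]) a p); last exact: big_allpairs.
apply: perm_big; apply: uniq_perm; rewrite ?fset_uniq//.
  by apply: allpairs_uniq; rewrite ?fset_uniq// => -[? ?] [? ?].
move=> [i j]; rewrite in_fsetM/=; apply/andP/allpairsP => [[iA jB]|[[i' j'] /= [iA jB [-> ->]]]//].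
by exists (i, j).
Qed.

(** Finitely many rows covering the projection of [A] can be cut by enough columns that the
    resulting rectangle contains [A] and nearly exhausts each chosen row; its sum is then close both
    to [S] and to the sum of the chosen [s i]. *)
Lemma has_sum_fst I J (a : I * J -> R) (s : I -> R) (S : R) :
  has_sum a S -> (forall i, has_sum (fun j => a (i, j)) (s i)) -> has_sum s S.
Proof.
move=> /has_sumP aS ais; apply/has_sumP => e e0.
have [A AB] := aS e e0.
exists [fset p.1 | p in A]%fset => I1 AI1.
apply/ler_addgt0Pr => e1 e10.
have /has_sumP/(_ e1 e10)[J0 HJ0] := has_sum_sum (r := enum_fset I1) ais.
pose J1 := (J0 `|` [fset p.2 | p in A])%fset.
have := HJ0 J1 (fsubsetUl _ _).
have : (A `<=` I1 `*` J1)%fset.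
  apply/fsubsetP => -[i j] ijA; rewrite in_fsetM/=; apply/andP; split.
    by apply: (fsubsetP AI1); apply/imfsetP; exists (i, j).
  by rewrite inE; apply/orP; right; apply/imfsetP; exists (i, j).
move=> /AB; rewrite big_fset_prod exchange_big/= => h1 h2.
rewrite -[X in `|X|](subrKA (\sum_(j <- J1) \sum_(i <- I1) a (i, j))).
by rewrite (le_trans (ler_normD _ _))// [leRHS]addrC lerD// distrC.
Qed.

Lemma has_sum_reindex I J (f : I -> J) (g : J -> I) (u : J -> R) s :
  cancel f g -> cancel g f -> has_sum u s -> has_sum (fun i => u (f i)) s.
Proof.
move=> fg gf /has_sumP us; apply/has_sumP => e e0.
have [A AB] := us e e0.
exists [fset g j | j in A]%fset => B AB'.
have := AB [fset f i | i in B]%fset.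
rewrite big_imfset//=; last by move=> x y _ _ /(can_inj fg).
apply; apply/fsubsetP => j jA; apply/imfsetP; exists (g j) => //=.
by apply: (fsubsetP AB'); apply/imfsetP; exists j.
Qed.

Lemma has_sum_snd I J (a : I * J -> R) (s : J -> R) (S : R) :
  has_sum a S -> (forall j, has_sum (fun i => a (i, j)) (s j)) -> has_sum s S.
Proof.
move=> aS aj.
pose sw (X Y : Type) (p : X * Y) := (p.2, p.1).
have sK (X Y : Type) : cancel (@sw X Y) (@sw Y X) by case.
exact: (has_sum_fst (has_sum_reindex (sK J I) (sK I J) aS)).
Qed.

Lemma abs_bounded_prod I J (a : I * J -> R) (C : I -> R) (D : R) :
  (forall i, abs_bounded (fun j => a (i, j)) (C i)) -> abs_bounded C D ->
  abs_bounded a D.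
Proof.
move=> aC CD A.
set I1 := [fset p.1 | p in A]%fset; set J1 := [fset p.2 | p in A]%fset.
have AIJ : (A `<=` I1 `*` J1)%fset.
  apply/fsubsetP => -[i j] ijA; rewrite in_fsetM/=; apply/andP; split.
    by apply/imfsetP; exists (i, j).
  by apply/imfsetP; exists (i, j).
apply: le_trans (CD I1).
apply: (@le_trans _ _ (\sum_(p <- (I1 `*` J1)%fset) `|a p|)).
  exact: ler_sum_fset.
rewrite (big_fset_prod _ _ (fun p => `|a p|)); apply: ler_sum => i _.
exact: le_trans (aC i J1) (ler_norm _).
Qed.

(** The row sums of absolute values dominate [s] and are compared with [D] on finite rectangles,
    where the order of summation can be exchanged. *)
Lemma abs_bounded_fst I J (a : I * J -> R) (s : I -> R) D :
  abs_bounded a D -> (forall i, has_sum (fun j => a (i, j)) (s i)) -> abs_bounded s D.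
Proof.
move=> aD ais A.
have aB i : abs_bounded (fun j => `|a (i, j)|) D.
  move=> B; under eq_bigr do rewrite normr_id.
  have := aD ([fset i] `*` B)%fset.
  by rewrite (big_fset_prod _ _ (fun p => `|a p|)) big_seq_fset1.
have /choice[t ht] : forall i, exists t, has_sum (fun j => `|a (i, j)|) t.
  by move=> i; exact: abs_bounded_has_sum (aB i).
have st i : `|s i| <= t i.
  apply: has_sum_norm_le (ais i) => B; apply: le_trans (has_sum_abs_bounded _ (ht i) B) => //.
  by under [leRHS]eq_bigr do rewrite normr_id.
apply: (@le_trans _ _ (\sum_(i <- A) t i)); first exact: ler_sum.
have /has_sumP H := has_sum_sum (r := enum_fset A) ht.
apply/ler_addgt0Pr => e e0; have [B /(_ B (fsubset_refl _))] := H e e0.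
have := aD (A `*` B)%fset; rewrite (big_fset_prod _ _ (fun p => `|a p|)) exchange_big/=.
rewrite ler_norml => h /andP[h1 _]; lra.
Qed.

Lemma sum_fset_iota (u : nat -> R) n :
  \sum_(i <- [fset i | i in iota 0 n]%fset) u i = \sum_(0 <= i < n) u i.
Proof. by rewrite big_imfset//= undup_id ?iota_uniq// /index_iota subn0. Qed.

Lemma fset_nat_sub_iota (A : {fset nat}) :
  exists n0, forall n, (n0 <= n)%N -> (A `<=` [fset i | i in iota 0 n])%fset.
Proof.
exists (\max_(j <- A) j).+1 => n An; apply/fsubsetP => i iA.
rewrite in_fset/= mem_iota/= add0n; apply: leq_trans An; rewrite ltnS.
by apply: (leq_bigmax_seq (F := id)).
Qed.

Lemma has_sum_series (u : nat -> R) s : has_sum u s -> series u @ \oo --> s.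
Proof.
move=> /has_sumP us; apply/cvgrPdist_le => e e0.
have [A AB] := us e e0; have [n0 An0] := fset_nat_sub_iota A.
near=> n.
have := AB [fset i | i in iota 0 n]%fset.
rewrite sum_fset_iota distrC; apply; apply: An0.
by near: n; exact: nbhs_infty_ge.
Unshelve. all: by end_near. Qed.

Lemma nneg_series_abs_bounded (u : nat -> R) C : (forall i, 0 <= u i) ->
  (forall n, \sum_(0 <= i < n) u i <= C) -> abs_bounded u C.
Proof.
move=> u0 uC A; have [n /(_ n (leqnn n)) An] := fset_nat_sub_iota A.
rewrite (le_trans _ (uC n))// -sum_fset_iota.
rewrite (eq_bigr u) => [|i _]; last by rewrite ger0_norm.
exact: ler_sum_fset.
Qed.

End has_sum_theory.
Arguments has_sum_single {R I} i x.
Arguments has_sumZ {R I} k {u s}.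

Section has_sum_nat.
Context {R : realType}.

Lemma has_sum_nat (u : nat -> R) C s : abs_bounded u C ->
  series u @ \oo --> s -> has_sum u s.
Proof.
move=> uC us; have [t ut] := abs_bounded_has_sum uC.
suff <- : t = s by [].
exact: (@cvg_unique _ (@norm_hausdorff _ R) _ _ _ _ (has_sum_series ut) us).
Qed.

Lemma has_sumS (u : nat -> R) C s : abs_bounded u C -> has_sum u s ->
  has_sum (fun n => u n.+1) (s - u 0%N).
Proof.
move=> uC us; apply: (@has_sum_nat _ C).
  move=> A; have := uC [fset i.+1 | i in A]%fset.
  by rewrite big_imfset//= => x y _ _ [].
rewrite (_ : series _ = fun n => series u n.+1 - u 0%N); last first.
  apply/funext => n; rewrite /series/= big_nat_recl//=.
  by rewrite addrC addKr.
apply: cvgB; last exact: cvg_cst.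
by have := has_sum_series us; rewrite -(cvg_shiftS (series u)).
Qed.

Lemma exp_abs_bounded (x : R) :
  abs_bounded (fun n => x ^+ n / n`!%:R) (expR `|x|).
Proof.
have h : abs_bounded (fun n => `|x| ^+ n / n`!%:R) (expR `|x|).
  apply: nneg_series_abs_bounded => [i|n]; first by rewrite divr_ge0// exprn_ge0.
  apply: (nondecreasing_cvgn_le (u_ := series (exp_coeff `|x|)) _ _ n).
    by apply/nondecreasing_seqP => k; rewrite /series/= big_nat_recr//= lerDl /exp_coeff/= divr_ge0// exprn_ge0.
  exact: is_cvg_series_exp_coeff.
apply: abs_boundedW h => // i.
by rewrite !normrM !normrX normr_id.
Qed.

Lemma exp_has_sum (x : R) : has_sum (fun n => x ^+ n / n`!%:R) (expR x).
Proof.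
apply: has_sum_nat (exp_abs_bounded x) _.
exact: is_cvg_series_exp_coeff.
Qed.

Arguments exp_has_sum : clear implicits.

(** Without its constant and linear terms the exponential leaves the second-order remainder
    estimated in [pser_exp_sub]. *)
Lemma exp_has_sum2 (x : R) :
  has_sum (fun n => x ^+ n.+2 / n.+2`!%:R) (expR x - 1 - x).
Proof.
have h0 := exp_abs_bounded x.
have h1 := has_sumS h0 (exp_has_sum x).
have h2 : abs_bounded (fun n => x ^+ n.+1 / n.+1`!%:R) (expR `|x|).
  move=> A; have := h0 [fset i.+1 | i in A]%fset.
  by rewrite big_imfset//= => a b _ _ [].
have := has_sumS h2 h1.
by rewrite expr0 expr1 divr1 divr1.
Qed.

End has_sum_nat.
Arguments exp_has_sum {R}.
Arguments exp_has_sum2 {R}.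

(** * Absolutely convergent power series *)

Section pser.
Context {R : realType} {d : nat}.
Local Notation mi := {ffun 'I_d -> nat}.
Implicit Types (f g h : 'rV[R]_d -> R) (r C D M : R) (u : 'rV[R]_d).

Definition mdegree (alpha : mi) : nat := (\sum_i alpha i)%N.

Definition madd (alpha beta : mi) : mi := [ffun i => (alpha i + beta i)%N].

Lemma monomialD alpha beta u :
  monomial (madd alpha beta) u = monomial alpha u * monomial beta u.
Proof.
by rewrite /monomial -big_split/=; apply: eq_bigr => i _; rewrite ffunE exprD.
Qed.

Lemma mdegreeD alpha beta : mdegree (madd alpha beta) = (mdegree alpha + mdegree beta)%N.
Proof. by rewrite /mdegree -big_split/=; apply: eq_bigr => i _; rewrite ffunE. Qed.

Lemma rV_norm_coord u i : `|u 0 i| <= `|u|.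
Proof.
rewrite [leRHS]/Num.norm/= mx_normrE; apply/bigmax_geP; right => /=.
by exists (ord0, i).
Qed.

Lemma monomial_le alpha u r : `|u| <= r -> `|monomial alpha u| <= r ^+ mdegree alpha.
Proof.
move=> ur; rewrite /monomial normr_prod /mdegree -prodrXr.
apply: ler_prod => i _; rewrite normr_ge0/= normrX lerXn2r ?nnegrE//.
  by rewrite (le_trans _ ur).
by rewrite (le_trans _ ur)// rV_norm_coord.
Qed.

(* f is the sum on the closed ball of radius r of a power series whose weighted
   l^1 norm is at most C. *)
Definition pser r C f := exists k : mi -> R,
  abs_bounded (fun alpha => k alpha * r ^+ mdegree alpha) C /\
  forall u, `|u| <= r -> has_sum (fun alpha => k alpha * monomial alpha u) (f u).

Lemma pser_term_le (c r : R) alpha u : `|u| <= r ->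
  `|c * monomial alpha u| <= `|c * r ^+ mdegree alpha|.
Proof.
move=> ur; have r0 : 0 <= r := le_trans (normr_ge0 _) ur.
rewrite !normrM ler_wpM2l// (le_trans (monomial_le alpha ur))//.
exact: ler_norm.
Qed.

Lemma eq_pser r C f g : (forall u, `|u| <= r -> f u = g u) -> pser r C f -> pser r C g.
Proof. by move=> fg [k [kC kf]]; exists k; split=> // u ur; rewrite -fg//; exact: kf. Qed.

Lemma pser_ge0 r C f : pser r C f -> 0 <= C.
Proof. by move=> [k [/abs_bounded_ge0]]. Qed.

Lemma pser_le r C f u : pser r C f -> `|u| <= r -> `|f u| <= C.
Proof.
move=> [k [kC kf]] ur; apply: has_sum_norm_le (kf u ur).
by apply: abs_boundedW kC => // i; exact: pser_term_le.
Qed.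

Lemma pserW r r' C C' f : 0 <= r' <= r -> C <= C' -> pser r C f -> pser r' C' f.
Proof.
move=> /andP[r'0 r'r] CC' [k [kC kf]]; exists k; split.
  apply: abs_boundedW kC => // i; rewrite !normrM ler_wpM2l//.
  by rewrite !ger0_norm ?exprn_ge0 ?(le_trans r'0)// lerXn2r ?nnegrE// (le_trans r'0).
by move=> u ur; apply: kf; exact: le_trans ur r'r.
Qed.

(* The same monomial may occur for several indices j; regrouping them is the
   only rearrangement needed for sums and products of power series. *)
Lemma pser_atoms (J : choiceType) (k : J -> R) (p : J -> mi) r C f : 0 <= r ->
  abs_bounded (fun j => k j * r ^+ mdegree (p j)) C ->
  (forall u, `|u| <= r -> has_sum (fun j => k j * monomial (p j) u) (f u)) ->
  pser r C f.
Proof.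
move=> r0 kC kf.
(* [a w] spreads the family over the graph of [p]: column [j] has its only possibly nonzero entry in
   row [p j], and row [ga] collects the terms that share the monomial [ga]. *)
pose a w (q : mi * J) : R := if q.1 == p q.2 then k q.2 * w (p q.2) else 0.
have aC w D : abs_bounded (fun j => k j * w (p j)) D -> abs_bounded (a w) D.
  move=> /(abs_boundedW (fun j => lexx _) (lexx _)) kD A.
  have {}kD : abs_bounded (fun j => `|k j * w (p j)|) D.
    by apply: abs_boundedW kD => // j; rewrite normr_id.
  have := @abs_bounded_prod R J mi (fun q => a w (q.2, q.1)) _ D _ kD [fset (q.2, q.1) | q in A]%fset.
  rewrite big_imfset/=; last by move=> [? ?] [? ?] _ _ /= [-> ->].
  under eq_bigr do rewrite -surjective_pairing.
  apply=> j B; rewrite /a/=.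
  case: (boolP (p j \in B)) => pB.
    rewrite (big_fsetD1 (p j))//= eqxx big1_seq ?addr0// => b /=.
    by rewrite !inE => /andP[/negbTE -> _]; rewrite normr0.
  rewrite big1_seq// => b /= bB; case: eqP => [bp|_]; last by rewrite normr0.
  by rewrite bp (negbTE pB) in bB.
have [sK hK] : exists K : mi -> R, forall ga, has_sum (fun j => a (fun=> 1) (ga, j)) (K ga) \/
   (K ga = 0 /\ r = 0 /\ mdegree ga != 0%N).
  suff /choice[K HK] : forall ga, exists s, has_sum (fun j => a (fun=> 1) (ga, j)) s \/
      (s = 0 /\ r = 0 /\ mdegree ga != 0%N) by exists K.
  move=> ga.
  case: (boolP (r ^+ mdegree ga == 0)) => [|rg].
    rewrite expf_eq0 => /andP[g0 /eqP ->]; exists 0; right; split => //; split => //.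
    by rewrite -lt0n.
  have [s hs] : exists s, has_sum (fun j => a (fun b => r ^+ mdegree b) (ga, j)) s.
    apply: (@abs_bounded_has_sum _ _ _ C) => A.
    have := aC (fun b => r ^+ mdegree b) C kC [fset (ga, j) | j in A]%fset.
    by rewrite big_imfset//= => x y _ _ [].
  exists ((r ^+ mdegree ga)^-1 * s); left.
  apply: eq_has_sum (has_sumZ (r ^+ mdegree ga)^-1 hs) => j; rewrite /a/=.
  case: eqP => [<-|_]; last by rewrite mulr0.
  by rewrite mulrC mulfK// mulr1.
have sumw w : (forall ga, r = 0 -> mdegree ga != 0%N -> w ga = 0) ->
    forall ga, has_sum (fun j => a w (ga, j)) (sK ga * w ga).
  move=> w0 ga; case: (hK ga) => [h|[K0 [r00 g0]]].
    rewrite mulrC; apply: eq_has_sum (has_sumZ (w ga) h) => j; rewrite /a/=.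
    by case: eqP => [<-|_]; rewrite ?mulr0// mulr1 mulrC.
  rewrite K0 mul0r; apply: eq_has_sum (has_sum0 _) => j; rewrite /a/=.
  by case: eqP => // <-; rewrite w0// mulr0.
exists sK; split.
  apply: abs_bounded_fst (aC (fun b => r ^+ mdegree b) C kC) _.
  by apply: sumw => ga -> /negbTE; rewrite expr0n => ->.
move=> u ur.
have kb : abs_bounded (fun j => k j * monomial (p j) u) C.
  by apply: abs_boundedW kC => // j; exact: pser_term_le.
have [S hS] := abs_bounded_has_sum (aC (fun al => monomial al u) C kb).
have -> : f u = S.
  apply: (has_sum_unique (kf u ur)); apply: has_sum_snd hS _ => j.
  apply: eq_has_sum (has_sum_single (p j) _) => ga /=.
  by rewrite /a/=; case: eqP => // ->.
apply: has_sum_fst hS _; apply: sumw => ga r00 g0.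
have := monomial_le ga ur; rewrite r00 expr0n (negbTE g0) normr_le0.
by move=> /eqP.
Qed.

Lemma pser_sum (J : choiceType) (F : J -> 'rV[R]_d -> R) (C : J -> R) r D f : 0 <= r ->
  (forall j, pser r (C j) (F j)) -> abs_bounded C D ->
  (forall u, `|u| <= r -> has_sum (F^~ u) (f u)) -> pser r D f.
Proof.
move=> r0 /choice[k hk] CD Ff.
have kD : abs_bounded (fun q : J * mi => k q.1 q.2 * r ^+ mdegree q.2) D.
  by apply: abs_bounded_prod CD => j; case: (hk j).
apply: (@pser_atoms (J * mi)%type (fun q => k q.1 q.2) (fun q => q.2)) => // u ur.
have [S hS] : exists S, has_sum (fun q : J * mi => k q.1 q.2 * monomial q.2 u) S.
  by apply: (@abs_bounded_has_sum _ _ _ D); apply: abs_boundedW kD => // q; exact: pser_term_le.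
suff -> : f u = S by [].
apply: has_sum_unique (Ff u ur) _; apply: has_sum_fst hS _ => j.
by case: (hk j) => _; apply.
Qed.

(** The weights [r ^+ mdegree alpha] are multiplicative in [alpha], so the weighted l^1 norm is
    submultiplicative; the Cauchy product arises by regrouping the double family. *)
Lemma pserM r C D f g : 0 <= r -> pser r C f -> pser r D g -> pser r (C * D) (fun u => f u * g u).
Proof.
move=> r0 [k [kC kf]] [l [lD lg]].
have D0 := abs_bounded_ge0 lD.
pose K (q : mi * mi) := k q.1 * l q.2.
have KCD : abs_bounded (fun q => K q * r ^+ mdegree (madd q.1 q.2)) (C * D).
  have kCD : abs_bounded (fun al => `|k al * r ^+ mdegree al| * D) (C * D).
    by move=> A; under eq_bigr do rewrite normrM normr_id (ger0_norm D0); rewrite -mulr_suml ler_wpM2r.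
  apply: abs_bounded_prod kCD => al.
  under eq_fun do rewrite /K/= mdegreeD exprD mulrACA.
  exact: abs_boundedZ.
apply: (pser_atoms (p := fun q => madd q.1 q.2) r0 KCD) => u ur.
have [S hS] : exists S, has_sum (fun q => K q * monomial (madd q.1 q.2) u) S.
  by apply: (@abs_bounded_has_sum _ _ _ (C * D)); apply: abs_boundedW KCD => // q; exact: pser_term_le.
suff -> : f u * g u = S by [].
rewrite mulrC; apply: has_sum_unique (has_sumZ (g u) (kf u ur)) _.
apply: has_sum_fst hS _ => al; rewrite mulrC.
apply: eq_has_sum (has_sumZ (k al * monomial al u) (lg u ur)) => be.
by rewrite /K/= monomialD mulrACA.
Qed.

Lemma pserZ r C f c : pser r C f -> pser r (`|c| * C) (fun u => c * f u).
Proof.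
move=> [k [kC kf]]; exists (fun al => c * k al); split.
  by under eq_fun do rewrite -mulrA; exact: abs_boundedZ.
by move=> u ur; under eq_fun do rewrite -mulrA; apply: has_sumZ; exact: kf.
Qed.

Lemma pserD r C D f g : pser r C f -> pser r D g -> pser r (C + D) (fun u => f u + g u).
Proof.
move=> [k [kC kf]] [l [lD lg]]; exists (fun al => k al + l al); split.
  by under eq_fun do rewrite mulrDl; exact: abs_boundedD.
by move=> u ur; under eq_fun do rewrite mulrDl; apply: has_sumD; [exact: kf|exact: lg].
Qed.

Lemma pserB r C D f g : pser r C f -> pser r D g -> pser r (C + D) (fun u => f u - g u).
Proof.
move=> hf hg; have := pserD hf (pserZ (-1) hg).
by rewrite normrN1 mul1r; apply: eq_pser => u _; rewrite mulN1r.
Qed.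

Lemma pser_monomial r c al : 0 <= r -> pser r `|c * r ^+ mdegree al| (fun u => c * monomial al u).
Proof.
move=> r0; apply: (@pser_atoms unit (fun=> c) (fun=> al)) => // [A|u ur].
  rewrite big_const_seq count_predT/= iter_addr_0 -[leRHS]mulr1n.
  rewrite -[leLHS]mulr_natr -[leRHS]mulr_natr ler_wpM2l// ler_nat; have : (#|` A| <= #|` [fset tt]%fset|)%N.
    by apply: fsubset_leq_card; apply/fsubsetP => -[] _; rewrite inE.
  by rewrite cardfs1.
have := has_sum_single tt (c * monomial al u).
by congr (has_sum _ _); apply/funext => -[]; rewrite eqxx.
Qed.

Lemma pser_cst r c : 0 <= r -> pser r `|c| (fun=> c).
Proof.
move=> r0; have := pser_monomial c [ffun=> 0%N] r0.
have -> : mdegree [ffun=> 0%N] = 0%N by rewrite /mdegree big1// => i _; rewrite ffunE.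
rewrite expr0 mulr1; apply: eq_pser => u _.
by rewrite /monomial big1 ?mulr1// => i _; rewrite ffunE expr0.
Qed.

Lemma pser_coord r i : 0 <= r -> pser r r (fun u => u 0 i).
Proof.
move=> r0; have := pser_monomial 1 [ffun j => (j == i : nat)] r0.
have -> : mdegree [ffun j => (j == i : nat)] = 1%N.
  rewrite /mdegree (bigD1 i)//= ffunE eqxx big1 ?addn0// => j ji.
  by rewrite ffunE (negbTE ji).
rewrite expr1 mul1r ger0_norm//; apply: eq_pser => u _.
rewrite mul1r /monomial (bigD1 i)//= ffunE eqxx expr1 big1 ?mulr1// => j ji.
by rewrite ffunE (negbTE ji) expr0.
Qed.

Lemma pserX r C f n : 0 <= r -> pser r C f -> pser r (C ^+ n) (fun u => f u ^+ n).
Proof.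
move=> r0 Cf; elim: n => [|n IH].
  rewrite expr0 -[X in pser _ X]normr1; apply: eq_pser (pser_cst 1 r0) => u _.
  by rewrite expr0.
rewrite exprS; apply: eq_pser (pserM r0 Cf IH) => u _; by rewrite exprS.
Qed.

Lemma pser_big (I : Type) (s : seq I) r (C : I -> R) (F : I -> 'rV[R]_d -> R) : 0 <= r ->
  (forall i, pser r (C i) (F i)) -> pser r (\sum_(i <- s) C i) (fun u => \sum_(i <- s) F i u).
Proof.
move=> r0 CF; elim: s => [|i s IH].
  rewrite big_nil; have := pser_cst 0 r0; rewrite normr0.
  by apply: eq_pser => u _; rewrite big_nil.
rewrite big_cons; apply: eq_pser (pserD (CF i) IH) => u _.
by rewrite big_cons.
Qed.

(** The difference of the powers n + 2 has f - g as a factor, hence norm at most (n + 2) M^(n+1) D;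
    after division by (n + 2)! this is at most D M (M^n / n!). The factor M, gained by removing the
    linear part, becomes the small constant of the contraction. *)
Lemma pser_exp_sub r M D f g : 0 <= r -> pser r M f -> pser r M g ->
  pser r D (fun u => f u - g u) ->
  pser r (D * M * expR M) (fun u => expR (f u) - expR (g u) - (f u - g u)).
Proof.
move=> r0 fM gM fgD.
have M0 := pser_ge0 fM; have D0 := pser_ge0 fgD.
have powD n : pser r (n.+1%:R * M ^+ n * D) (fun u => f u ^+ n.+1 - g u ^+ n.+1).
  elim: n => [|n IH].
    by rewrite expr0 mulr1 mul1r; apply: eq_pser fgD => u _; rewrite !expr1.
  have := pserD (pserM r0 fM IH) (pserM r0 fgD (pserX n.+1 r0 gM)).
  rewrite [X in pser r X _](_ : _ = n.+2%:R * M ^+ n.+1 * D); last first.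
    by rewrite -[n.+2%:R]natr1 exprS; ring.
  by apply: eq_pser => u _; rewrite ![_ ^+ n.+2]exprS; ring.
apply: (@pser_sum nat (fun n u => (f u ^+ n.+2 - g u ^+ n.+2) / n.+2`!%:R)
  (fun n => D * M * (M ^+ n / n`!%:R))) => //.
- move=> n; have := pserZ (n.+2`!%:R^-1) (powD n.+1).
  move/(pserW (r' := r) (C' := D * M * (M ^+ n / n`!%:R))).
  move=> H; apply: eq_pser (H _ _).
  + by move=> u _; rewrite mulrC.
  + by rewrite r0 lexx.
  rewrite gtr0_norm ?invr_gt0 ?ltr0n ?fact_gt0// !factS !natrM exprS.
  have fld (a b c P : R) : a != 0 -> b != 0 -> c != 0 ->
      (b * (a * c))^-1 * (b * (M * P) * D) = D * M * (P / c) * a^-1.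
    by move=> a0 b0 c0; field; rewrite ?a0 ?b0 ?c0.
  have n1 : (n.+1%:R : R) != 0 by rewrite pnatr_eq0.
  have n2 : (n.+2%:R : R) != 0 by rewrite pnatr_eq0.
  have nf : (n`!%:R : R) != 0 by rewrite pnatr_eq0 -lt0n fact_gt0.
  rewrite fld//.
  rewrite ler_piMr//; last by rewrite invf_le1 ?ltr0n// ler1n.
  by rewrite !mulr_ge0// ?invr_ge0// exprn_ge0.
- have := abs_boundedZ (D * M) (exp_abs_bounded M).
  by rewrite (ger0_norm (mulr_ge0 D0 M0)) (ger0_norm M0).
- move=> u ur; have := has_sumB (exp_has_sum2 (f u)) (exp_has_sum2 (g u)).
  have -> : expR (f u) - 1 - f u - (expR (g u) - 1 - g u) = expR (f u) - expR (g u) - (f u - g u) by ring.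
  by apply: eq_has_sum => n; rewrite mulrBl.
Qed.

Lemma pser_exp_sub1 r M f : 0 <= r -> pser r M f ->
  pser r (M + M * M * expR M) (fun u => expR (f u) - 1).
Proof.
move=> r0 fM; have M0 := pser_ge0 fM.
have g0 : pser r M (fun=> 0).
  by apply: pserW (pser_cst 0 r0); rewrite ?r0 ?lexx// normr0.
have fg : pser r M (fun u => f u - 0) by apply: eq_pser fM => u _; rewrite subr0.
have := pserD fM (pser_exp_sub r0 fM g0 fg).
by apply: eq_pser => u _; rewrite expR0; ring.
Qed.

End pser.

(** * Derivatives of power series *)

Section jets.
Context {R : realType} {d : nat}.
Local Notation mi := {ffun 'I_d -> nat}.
Implicit Types (f g h : 'rV[R]_d -> R) (r C D M : R) (u v w : 'rV[R]_d).

(* First-order expansions in s of q w s, uniform in w. The norm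
   N0 + N1 + N2 is submultiplicative, so a monomial of degree n expanded in the
   direction v costs only (r + |v|)^n. *)
Definition expansion r (N : R) (q : 'rV[R]_d -> R -> R) (q0 q1 : 'rV[R]_d -> R) :=
  exists N0 N1 N2 : R, [/\ N0 + N1 + N2 <= N, 0 <= N2, pser r N0 q0, pser r N1 q1 &
    forall w (s : R), `|w| <= r -> `|s| <= 1 -> `|q w s - q0 w - s * q1 w| <= N2 * s ^+ 2].

Lemma expansion_coord r v i : 0 <= r ->
  expansion r (r + `|v|) (fun w s => (w + s *: v) 0 i) (fun w => w 0 i) (fun=> v 0 i).
Proof.
move=> r0; exists r, `|v 0 i|, 0; split => //.
- by rewrite addr0 lerD2l rV_norm_coord.
- exact: pser_coord.
- exact: pser_cst.
- by move=> w s _ _; rewrite !mxE [w 0 i + _]addrC addrK subrr normr0 mul0r.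
Qed.

Lemma expansion_cst r c : 0 <= r -> expansion r `|c| (fun _ _ => c) (fun=> c) (fun=> 0).
Proof.
move=> r0; exists `|c|, 0, 0; split => //.
- by rewrite !addr0.
- exact: pser_cst.
- by have := pser_cst (d := d) (0 : R) r0; rewrite normr0.
- by move=> w s _ _; rewrite mulr0 !subr0 subrr normr0 mul0r.
Qed.

Lemma expansionM r N N' q q0 q1 q' q0' q1' : 0 <= r ->
  expansion r N q q0 q1 -> expansion r N' q' q0' q1' ->
  expansion r (N * N') (fun w s => q w s * q' w s) (fun w => q0 w * q0' w)
    (fun w => q0 w * q1' w + q1 w * q0' w).
Proof.
move=> r0 [N0 [N1 [N2 [NN N20 p0 p1 hq]]]] [M0 [M1 [M2 [MM M20 p0' p1' hq']]]].
have N00 := pser_ge0 p0; have N10 := pser_ge0 p1.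
have M00 := pser_ge0 p0'; have M10 := pser_ge0 p1'.
(* All products of total order at least 2 in [s] go into the remainder; those of order 3 and 4 are
   absorbed because |s| <= 1. *)
exists (N0 * M0), (N0 * M1 + N1 * M0), (N0 * M2 + N2 * M0 + N1 * M1 + N1 * M2 + N2 * M1 + N2 * M2).
split.
- apply: (@le_trans _ _ ((N0 + N1 + N2) * (M0 + M1 + M2))); first by rewrite le_eqVlt; apply/orP; left; apply/eqP; ring.
  by apply: ler_pM => //; rewrite !addr_ge0.
- by rewrite !addr_ge0// mulr_ge0.
- exact: pserM.
- by apply: pserD; exact: pserM.
- move=> w s wr s1.
  have a0 := pser_le p0 wr; have a1 := pser_le p1 wr.
  have b0 := pser_le p0' wr; have b1 := pser_le p1' wr.
  move: (hq w s wr s1) (hq' w s wr s1); move: (q0 w) (q1 w) (q0' w) (q1' w) a0 a1 b0 b1.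
  move=> x0 x1 y0 y1 a0 a1 b0 b1.
  set e := q w s - _ - _; set e' := q' w s - _ - _ => he he'.
  have -> : q w s * q' w s - x0 * y0 - s * (x0 * y1 + x1 * y0) =
    x0 * e' + e * y0 + s ^+ 2 * (x1 * y1) + s * (x1 * e') + s * (e * y1) + e * e'.
    by rewrite /e /e'; ring.
  clearbody e e'.
  have s20 : 0 <= s ^+ 2 by rewrite sqr_ge0.
  have s21 : s ^+ 2 <= 1 by rewrite -real_normK ?num_real// expr_le1.
  have T (a b A B : R) : `|a| <= A -> `|b| <= B -> `|a * b| <= A * B.
    by move=> ? ?; rewrite normrM ler_pM.
  have S1 (a A : R) : `|a| <= A -> `|s * a| <= A.
    by move=> aA; rewrite normrM (le_trans _ aA)// ler_piMl.
  have t1 : `|x0 * e'| <= N0 * M2 * s ^+ 2 by rewrite -mulrA; exact: T.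
  have t2 : `|e * y0| <= N2 * M0 * s ^+ 2 by rewrite mulrAC; exact: T.
  have t3 : `|s ^+ 2 * (x1 * y1)| <= N1 * M1 * s ^+ 2.
    by rewrite mulrC; apply: (T (x1 * y1)); [exact: T|rewrite ger0_norm].
  have t4 : `|s * (x1 * e')| <= N1 * M2 * s ^+ 2 by apply: S1; rewrite -mulrA; exact: T.
  have t5 : `|s * (e * y1)| <= N2 * M1 * s ^+ 2 by apply: S1; rewrite mulrAC; exact: T.
  have t6 : `|e * e'| <= N2 * M2 * s ^+ 2.
    apply: le_trans (T _ _ _ _ he he') _.
    rewrite mulrACA ler_wpM2l ?mulr_ge0//.
    by rewrite ler_piMr.
  rewrite !mulrDl; apply: le_trans (ler_normD _ _) (lerD _ t6).
  apply: le_trans (ler_normD _ _) (lerD _ t5).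
  apply: le_trans (ler_normD _ _) (lerD _ t4).
  apply: le_trans (ler_normD _ _) (lerD _ t3).
  exact: le_trans (ler_normD _ _) (lerD t1 t2).
Qed.

Lemma expansion_monomial r v al : 0 <= r -> exists q1,
  expansion r ((r + `|v|) ^+ mdegree al) (fun w s => monomial al (w + s *: v))
    (fun w => monomial al w) q1.
Proof.
move=> r0; rewrite /monomial /mdegree -prodrXr.
have c1 : expansion r 1 (fun _ _ => 1) (fun=> 1) (fun=> 0).
  by have := expansion_cst 1 r0; rewrite normr1.
have hX i n : exists q1, expansion r ((r + `|v|) ^+ n)
    (fun w s => (w + s *: v) 0 i ^+ n) (fun w => w 0 i ^+ n) q1.
  elim: n => [|n [q1 IH]]; first by exists (fun=> 0).
  eexists; under [X in expansion _ _ X]eq_fun do under eq_fun do rewrite exprS.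
  under [X in expansion _ _ _ X]eq_fun do rewrite exprS.
  rewrite exprS; exact: expansionM (expansion_coord v i r0) IH.
elim: (index_enum _) => [|i s [q1 IH]].
  rewrite big_nil; exists (fun=> 0).
  under [X in expansion _ _ X]eq_fun do under eq_fun do rewrite big_nil.
  by under [X in expansion _ _ _ X]eq_fun do rewrite big_nil.
have [q1' h] := hX i (al i).
eexists; under [X in expansion _ _ X]eq_fun do under eq_fun do rewrite big_cons.
under [X in expansion _ _ _ X]eq_fun do rewrite big_cons.
rewrite big_cons; exact: expansionM h IH.
Qed.

(** Expanding a monomial of degree n costs (r + |v|)^n <= r'^n, so shrinking the radius by |v| pays
    for the whole expansion, and the same [C] bounds both the derivative and the remainder. *)
Lemma pser_derive r r' C f v : 0 <= r -> r + `|v| <= r' -> pser r' C f ->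
  exists h, pser r C h /\ forall w (s : R), `|w| <= r -> `|s| <= 1 ->
    `|f (w + s *: v) - f w - s * h w| <= C * s ^+ 2.
Proof.
move=> r0 rr' [k [kC kf]].
have r'0 : 0 <= r' by rewrite (le_trans _ rr')// addr_ge0.
have /choice[q1 hq1] := fun al => expansion_monomial v al r0.
pose B (al : mi) := (r + `|v|) ^+ mdegree al.
have B0 al : 0 <= B al by rewrite exprn_ge0// addr_ge0.
have kB : abs_bounded (fun al => k al * B al) C.
  apply: abs_boundedW kC => // al; rewrite !normrM ler_wpM2l//.
  by rewrite /B !ger0_norm ?exprn_ge0 ?addr_ge0// lerXn2r// nnegrE addr_ge0.
have hq al : pser r (B al) (q1 al) /\ forall w (s : R), `|w| <= r -> `|s| <= 1 ->
    `|monomial al (w + s *: v) - monomial al w - s * q1 al w| <= B al * s ^+ 2.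
  have [N0 [N1 [N2 [NN N20 p0 p1 H]]]] := hq1 al.
  have N00 := pser_ge0 p0; have N10 := pser_ge0 p1; rewrite -/(B al) in NN.
  split; first by apply: pserW p1; rewrite ?r0 ?lexx//; lra.
  move=> w s wr s1; apply: le_trans (H w s wr s1) _.
  by rewrite ler_wpM2r ?sqr_ge0//; lra.
have hh w : exists s, `|w| <= r -> has_sum (fun al => k al * q1 al w) s.
  have [wr|wr] := pselect (`|w| <= r); last by exists 0.
  have [s hs] : exists s, has_sum (fun al => k al * q1 al w) s.
    apply: (@abs_bounded_has_sum _ _ _ C); apply: abs_boundedW kB => // al.
    rewrite !normrM ler_wpM2l// (le_trans (pser_le (hq al).1 wr))//.
    exact: ler_norm.
  by exists s.
have [h {}hh] := choice hh.
exists h; split.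
  apply: (@pser_sum _ _ _ (fun al w => k al * q1 al w) (fun al => `|k al| * B al)) => //.
  - by move=> al; apply: pserZ; case: (hq al).
  - by apply: abs_boundedW kB => // al; rewrite !normrM normr_id.
move=> w s wr s1.
have wr' : `|w| <= r' by rewrite (le_trans wr)// (le_trans _ rr')// lerDl.
have wsr' : `|w + s *: v| <= r'.
  rewrite (le_trans (ler_normD _ _))// (le_trans _ rr')// lerD// normrZ.
  by rewrite ler_piMl.
have := has_sumB (has_sumB (kf _ wsr') (kf _ wr')) (has_sumZ s (hh _ wr)).
move=> H; have := abs_boundedZ (s ^+ 2) kB; rewrite (ger0_norm (sqr_ge0 s)) mulrC => K.
apply: has_sum_norm_le H; apply: abs_boundedW K => // al.
have -> : k al * monomial al (w + s *: v) - k al * monomial al w - s * (k al * q1 al w)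
  = k al * (monomial al (w + s *: v) - monomial al w - s * q1 al w) by ring.
have -> : `|s ^+ 2 * (k al * B al)| = `|k al| * (B al * s ^+ 2).
  by rewrite normrM (ger0_norm (sqr_ge0 s)) normrM (ger0_norm (B0 al)); ring.
rewrite normrM ler_wpM2l//; exact: (hq al).2.
Qed.

(** The expansion is taken at 0 with step s = |u| / r along u / s, a vector of length r; the linear
    term and the remainder each contribute at most C s. *)
Lemma pser_lip r C f u : 0 < r -> pser r C f -> `|u| <= r ->
  `|f u - f 0| <= 2 * C / r * `|u|.
Proof.
move=> r0 fC ur; have C0 := pser_ge0 fC.
have [->|u0] := eqVneq u 0; first by rewrite subrr normr0 normr0 mulr0.
have nu : 0 < `|u| by rewrite normr_gt0.
pose s := `|u| / r; have s0 : 0 < s by rewrite divr_gt0.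
have s1 : s <= 1 by rewrite ler_pdivrMr// mul1r.
have vr : 0 + `|s^-1 *: u| <= r.
  by rewrite add0r normrZ gtr0_norm ?invr_gt0// /s invf_div mulfVK// gt_eqF.
have [h [hC]] := pser_derive (lexx 0) vr fC.
move=> /(_ 0 s); rewrite normr0 (gtr0_norm s0) => /(_ (lexx _) s1).
rewrite add0r scalerA divff ?gt_eqF// scale1r => H.
have h0 : `|h 0| <= C by apply: pser_le hC _; rewrite normr0.
have -> : 2 * C / r * `|u| = C * s + C * s by rewrite /s; ring.
rewrite -[X in `|X|](subrK (s * h 0)) (le_trans (ler_normD _ _))// lerD//.
  by rewrite (le_trans H)// ler_wpM2l// expr2 ler_piMl// ltW.
by rewrite normrM (gtr0_norm s0) mulrC ler_wpM2r// ltW.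
Qed.

End jets.

(** * Analyticity at a point and directional derivatives *)

Section analytic_at.
Context {R : realType} {d : nat}.
Implicit Types (f g h : 'rV[R]_d -> R) (p u v w : 'rV[R]_d).

Lemma is_derive_quad (V : normedModType R) (g : V -> R) (x v : V) (l K e : R) : 0 < e ->
  (forall t : R, `|t| <= e -> `|g (x + t *: v) - g x - t * l| <= K * t ^+ 2) ->
  is_derive x v g l.
Proof.
move=> e0 H.
have K0 : 0 <= K.
  have := H e; rewrite ger0_norm ?(ltW e0)// => /(_ (lexx _)) /(le_trans (normr_ge0 _)).
  by rewrite pmulr_lge0// exprn_gt0.
suff H' : (fun z => z^-1 *: ((g \o shift x) (z *: v) - g x)) @ 0^' --> l.
  by apply: DeriveDef; [exact: cvgP H'|exact: cvg_lim H'].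
apply/cvgrPdist_le => eps eps0; near=> t.
have t0 : t != 0 by near: t; exact: nbhs_dnbhs_neq.
have te : `|t| <= e by near: t; apply: (@dnbhs0_le R R) => //.
have tK : `|t| <= eps / (K + 1) by near: t; apply: (@dnbhs0_le R R); rewrite divr_gt0//; lra.
have := H t te; rewrite /= [t *: v + x]addrC.
have -> : l - t^-1 *: (g (x + t *: v) - g x) = - t^-1 * (g (x + t *: v) - g x - t * l).
  by rewrite /GRing.scale/=; field.
rewrite normrM normrN normfV => h.
rewrite mulrC ler_pdivrMr ?normr_gt0//.
apply: (le_trans h); rewrite -real_normK ?num_real// expr2 mulrA ler_wpM2r//.
rewrite (le_trans (ler_wpM2l K0 tK))// mulrCA ger_pMr//.
by rewrite ler_pdivrMr ?mul1r; lra.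
Unshelve. all: by end_near. Qed.

(** Besides convergence this records a bound on the weighted norm, in a form that directional
    derivatives inherit. *)
Definition analytic_at g p := exists r C, 0 < r /\ pser r C (fun u => g (p + u)).

Lemma analytic_at_continuous g p : analytic_at g p -> {for p, continuous g}.
Proof.
move=> [r [C [r0 gC]]]; suff : g x @[x --> p] --> g p by [].
apply/(@cvgrPdist_le _ _ _ (nbhs p)) => e e0.
have C0 := pser_ge0 gC.
have K0 : 0 <= 2 * C / r by rewrite divr_ge0 ?mulr_ge0// ltW.
near=> x.
have xr : `|x - p| <= r.
  by rewrite distrC; near: x; apply: (@cvgr_dist_le _ _ _ _ _ id p) => //; exact: cvg_id.
have xe : `|x - p| <= e / (2 * C / r + 1).
  rewrite distrC; near: x; apply: (@cvgr_dist_le _ _ _ _ _ id p); first exact: cvg_id.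
  by rewrite divr_gt0//; lra.
have := pser_lip r0 gC xr; rewrite subrKC addr0 distrC => /le_trans; apply.
rewrite (le_trans (ler_wpM2l K0 xe))// mulrCA ger_pMr// ler_pdivrMr ?mul1r; lra.
Unshelve. all: by end_near. Qed.

(** Uniformity in [w] yields the derivative along [v] at all nearby points at once, and [h], being a
    power series, shows that this derivative is analytic again. *)
Lemma analytic_at_expansion g p v : analytic_at g p -> exists r s C K h,
  [/\ 0 < r, 0 < s, pser r C h & forall w (t : R), `|w| <= r -> `|t| <= s ->
    `|g (p + w + t *: v) - g (p + w) - t * h w| <= K * t ^+ 2].
Proof.
move=> [r [C [r0 gC]]].
(* Rescaling makes [s *: v] no longer than r / 2, so half of the radius remains; the added 1 covers
   v = 0. *)
pose s := r / 2 / (`|v| + 1).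
have s0 : 0 < s by rewrite !divr_gt0// ltr_wpDl.
have r20 : 0 < r / 2 by rewrite divr_gt0.
have rv : r / 2 + `|s *: v| <= r.
  have : `|s *: v| <= r / 2; last by lra.
  rewrite normrZ (gtr0_norm s0) /s mulrAC ler_pdivrMr ?ltr_wpDl//.
  by rewrite ler_wpM2l ?(ltW r20)// lerDl.
have [h [hC H]] := pser_derive (ltW r20) rv gC.
exists (r / 2), s, (`|s^-1| * C), (C / s ^+ 2), (fun w => s^-1 * h w); split => //.
  exact: pserZ.
move=> w t wr ts.
have ts1 : `|t / s| <= 1 by rewrite normrM normfV (gtr0_norm s0) ler_pdivrMr// mul1r.
have := H w (t / s) wr ts1; rewrite scalerA divfK ?gt_eqF// addrA.
have -> : C / s ^+ 2 * t ^+ 2 = C * (t / s) ^+ 2 by field; rewrite gt_eqF.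
by have -> : t * (s^-1 * h w) = t / s * h w by rewrite mulrA.
Qed.

Lemma analytic_at_derive g p v : analytic_at g p ->
  (exists2 r, 0 < r & forall x, `|x - p| <= r -> derivable g x v) /\ analytic_at ('D_v g) p.
Proof.
move=> /(analytic_at_expansion v)[r [s [C [K [h [r0 s0 hC H]]]]]].
have D w : `|w| <= r -> is_derive (p + w) v g (h w).
  by move=> wr; apply: (@is_derive_quad _ _ _ _ _ K s) => // t; exact: H.
split.
  exists r => // x xr; have := D (x - p) xr; rewrite subrKC => ?.
  exact: ex_derive.
exists r, C; split => //; apply: eq_pser hC => u ur; have := D u ur => Du.
by rewrite derive_val.
Qed.

Lemma analytic_at_taylor1 g p v : analytic_at g p -> exists s K : R,
  0 < s /\ forall t, `|t| <= s -> `|g (p + t *: v) - g p - t * 'D_v g p| <= K * t ^+ 2.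
Proof.
move=> /(analytic_at_expansion v)[r [s [C [K [h [r0 s0 _ H]]]]]].
exists s, K; split => // t ts.
have r00 : `|0 : 'rV[R]_d| <= r by rewrite normr0 ltW.
have D : is_derive (p + 0) v g (h 0).
  by apply: (@is_derive_quad _ _ _ _ _ K s) => // t' t's; exact: H.
have -> : 'D_v g p = h 0 by rewrite -[p]addr0 derive_val.
by have := H 0 t r00 ts; rewrite addr0.
Qed.

Lemma analytic_at_continuously_differentiable (U : set 'rV[R]_d) n g :
  (forall p, U p -> analytic_at g p) -> continuously_differentiable U n g.
Proof.
elim: n g => [|n IH] g gU /=.
  split => //; apply: continuous_in_subspaceT => x; rewrite inE => /gU.
  exact: analytic_at_continuous.
split.
  apply: continuous_in_subspaceT => x; rewrite inE => /gU.
  exact: analytic_at_continuous.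
move=> i; split => [x /gU /(analytic_at_derive (delta_mx 0 i))[[r r0 H] _]|].
  by apply: H; rewrite subrr normr0 ltW.
by apply: IH => p /gU /(analytic_at_derive (delta_mx 0 i))[].
Qed.

Lemma analytic_at_real_analytic (U : set 'rV[R]_d) g :
  (forall p, U p -> analytic_at g p) -> real_analytic U g.
Proof.
move=> gU p /gU[r [C [r0 [k [_ kg]]]]]; exists k.
near=> x; have := kg (x - p); rewrite subrKC; apply.
by rewrite distrC; near: x; apply: (@cvgr_dist_le _ _ _ _ _ id p) => //; exact: cvg_id.
Unshelve. all: by end_near. Qed.

Lemma is_derive_line g x v (t : R) : derivable g (x + t *: v) v ->
  is_derive t 1 (fun s : R => g (x + s *: v)) ('D_v g (x + t *: v)).
Proof.
move=> gd; have H : (fun z => z^-1 *: (((fun s : R => g (x + s *: v)) \o shift t) (z *: (1 : R)) - g (x + t *: v))) =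
  (fun z => z^-1 *: ((g \o shift (x + t *: v)) (z *: v) - g (x + t *: v))).
  apply/funext => z /=; congr (_ *: (g _ - _)).
  by rewrite [z *: 1]mulr1 scalerDl addrCA.
by split; rewrite /derivable /derive H.
Qed.

End analytic_at.

(** * The implicit function *)

Section sumR.
Context {R : realType}.

Definition sumR (I : choiceType) (a : I -> R) : R := xget 0 [set s | has_sum a s].

Lemma sumRP (I : choiceType) (a : I -> R) C : abs_bounded a C -> has_sum a (sumR a).
Proof. by move=> /abs_bounded_has_sum[s hs]; rewrite /sumR; case: xgetP => // /(_ s). Qed.

Lemma half_exp_abs_bounded (c : R) : 0 <= c -> abs_bounded (fun n => c / 2 ^+ n.+1) c.
Proof.
move=> c0; apply: nneg_series_abs_bounded => [i|n]; first by rewrite divr_ge0// exprn_ge0.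
suff -> : \sum_(0 <= i < n) c / 2 ^+ i.+1 = c * (1 - (2 ^+ n)^-1).
  by rewrite ler_piMr// gerBl invr_ge0 exprn_ge0.
elim: n => [|n IH]; first by rewrite big_nil expr0 invr1 subrr mulr0.
have t0 : (2 ^+ n : R) != 0 by rewrite expf_neq0.
rewrite big_nat_recr//= IH exprS; by field.
Qed.

Lemma sqr_le_expR (c x : R) : 0 < c -> 0 <= x -> x ^+ 2 <= 2 / c ^+ 2 * expR (c * x).
Proof.
move=> c0 x0; have := @expR_ge1Dxn R (c * x) 1 (mulr_ge0 (ltW c0) x0).
rewrite exprMn (_ : 2`! = 2)%N// => h.
rewrite mulrAC ler_pdivlMr ?exprn_gt0// mulrC -ler_pdivrMl//.
apply: le_trans h; rewrite mulrC; lra.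
Qed.

End sumR.

Section implicit.
Context {R : realType} {d : nat}.
Variables (E lam nl : nat -> R) (l : nat -> 'rV[R]_d -> R) (rho H : R).
Hypotheses (E0 : forall i, 0 <= E i) (lam0 : forall i, 0 <= lam i) (nl0 : forall i, 0 <= nl i).
Hypothesis lP : forall i r, 0 <= r -> pser r (r * nl i) (l i).
Hypothesis E1 : has_sum E 1.
Hypothesis Elam : exists j, 0 < E j * lam j.
Hypothesis rho0 : 0 < rho.
Hypothesis EH : abs_bounded (fun i => E i * expR (rho * (lam i * (nl i + 1)))) H.
(** If both the radius and the norm of [t] are at most [de], the exponent [lam i * (l i - t)] has
    norm at most [de * N i]: [nl i] accounts for the linear form and 1 for [t]. *)
Let N i := lam i * (nl i + 1).

Let N0 i : 0 <= N i. Proof. by rewrite mulr_ge0// addr_ge0. Qed.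

Let lamN i : lam i <= N i. Proof. by rewrite /N ler_peMr// lerDr. Qed.

Let H0 : 0 <= H. Proof. exact: abs_bounded_ge0 EH. Qed.

Let EN_le i : E i * N i <= rho^-1 * (E i * expR (rho * N i)).
Proof.
rewrite [leRHS]mulrCA ler_wpM2l// ler_pdivlMl//.
by apply: le_trans (expR_ge1Dx _); rewrite lerDr.
Qed.

Let Elam_le i : E i * lam i <= rho^-1 * (E i * expR (rho * N i)).
Proof. by apply: le_trans (EN_le i); rewrite ler_wpM2l. Qed.

Let A := sumR (fun i => E i * lam i).

Let AP : has_sum (fun i => E i * lam i) A.
Proof.
apply: (@sumRP _ _ _ (`|rho^-1| * H)).
apply: abs_boundedW (abs_boundedZ rho^-1 EH) => // i.
by rewrite !ger0_norm ?mulr_ge0// ?invr_ge0 ?(ltW rho0)// expR_ge0.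
Qed.

Let A0 : 0 < A.
Proof.
have [j jE] := Elam; apply: (lt_le_trans jE).
have h := has_sum_abs_bounded (fun i => mulr_ge0 (E0 i) (lam0 i)) AP.
exact: le_trans (ler_norm _) (abs_bounded_term j h).
Qed.

(** Half of the exponential weight [expR (rho * N i)] pays for the factor [N i ^+ 2], the other half
    for [expR (de * N i)]. *)
Let ENN_le : exists2 K : R, 0 < K & forall i (de : R), de <= rho / 2 ->
  E i * (N i ^+ 2 * expR (de * N i)) <= K * (E i * expR (rho * N i)).
Proof.
have r20 : 0 < rho / 2 by rewrite divr_gt0.
exists (2 / (rho / 2) ^+ 2) => [|i de der]; first by rewrite divr_gt0// exprn_gt0.
rewrite [leRHS]mulrCA ler_wpM2l//.
apply: (@le_trans _ _ (2 / (rho / 2) ^+ 2 * expR (rho / 2 * N i) * expR (rho / 2 * N i))).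
  apply: ler_pM; rewrite ?sqr_ge0 ?expR_ge0//; first exact: sqr_le_expR.
  by rewrite ler_expR ler_wpM2r.
by rewrite -mulrA -expRD -mulrDl -splitr.
Qed.

Let S (t : 'rV[R]_d -> R) u := sumR (fun i => E i * expR (lam i * (l i u - t u))).

(** The Newton map with frozen derivative: at u = 0 and t = 0 the derivative of [S] in t is - [A],
    so the linear dependence of [Phi] on [t] cancels. *)
Let Phi (t : 'rV[R]_d -> R) u := t u + A^-1 * (S t u - 1).

Section contraction.
Variables (de r K : R).
Hypothesis K0 : 0 < K.
Hypothesis ENN : forall i (de : R), de <= rho / 2 ->
  E i * (N i ^+ 2 * expR (de * N i)) <= K * (E i * expR (rho * N i)).
Hypotheses (de0 : 0 < de) (r0 : 0 < r) (rde : r <= de) (derho : de <= rho / 2) (r1 : r <= 1).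
Hypothesis deK : de * K * H <= A / 2.
Hypothesis rK : r * (rho^-1 + K) * H <= A * (de / 2).

Let zP i t : pser r de t -> pser r (de * N i) (fun u => lam i * (l i u - t u)).
Proof.
move=> tde; apply: pserW (pserZ (lam i) (pserB (lP i (ltW r0)) tde)).
  by rewrite lexx ltW.
rewrite ger0_norm// /N mulrCA ler_wpM2l//.
by rewrite [leRHS]mulrDr mulr1 lerD2r ler_wpM2r.
Qed.

Let SP t u : pser r de t -> `|u| <= r ->
  has_sum (fun i => E i * expR (lam i * (l i u - t u))) (S t u).
Proof.
move=> tde ur; apply: (@sumRP _ _ _ H); apply: abs_boundedW EH => // i.
rewrite !ger0_norm ?mulr_ge0 ?expR_ge0// ler_wpM2l// ler_expR.
apply: le_trans (ler_norm _) _; apply: le_trans (pser_le (zP i tde) ur) _.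
rewrite ler_wpM2r//; have := rho0; move: derho; lra.
Qed.

(** The choice of [A] removes the linear terms; what is left is a sum of second-order differences of
    exponentials, of norm at most [A^-1 * D * de * K * H], and [deK] turns this into [D / 2]. *)
Let lipschitz D t t' : pser r de t -> pser r de t' -> pser r D (fun u => t u - t' u) ->
  pser r (D / 2) (fun u => Phi t u - Phi t' u).
Proof.
move=> tde tde' ttD; have D0 := pser_ge0 ttD.
have fP i : pser r (lam i * D * (de * N i) * expR (de * N i))
    (fun u => expR (lam i * (l i u - t u)) - expR (lam i * (l i u - t' u)) -
      (lam i * (l i u - t u) - lam i * (l i u - t' u))).
  apply: pser_exp_sub; [exact: ltW|exact: zP|exact: zP|].
  have := pserZ (- lam i) ttD; rewrite normrN (ger0_norm (lam0 i)).
  by apply: eq_pser => u _; ring.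
have B := abs_boundedZ (A^-1 * D * de * K) EH.
have ADK : 0 <= A^-1 * D * de * K.
  by rewrite !mulr_ge0 ?invr_ge0 ?(ltW A0) ?(ltW de0) ?(ltW K0).
apply: (pser_sum (ltW r0) (fun i => pserZ (A^-1 * E i) (fP i)) (D := D / 2)).
  apply: abs_boundedW B => [i|].
    have Ei0 : 0 <= A^-1 * E i by rewrite mulr_ge0// invr_ge0 ltW.
    rewrite (ger0_norm Ei0) (ger0_norm (mulr_ge0 Ei0 (pser_ge0 (fP i)))).
    rewrite [leRHS]ger0_norm ?mulr_ge0 ?expR_ge0 ?invr_ge0 ?(ltW A0) ?(ltW de0) ?(ltW K0)//.
    have h := ENN i derho.
    apply: (@le_trans _ _ (A^-1 * D * de * (E i * (N i ^+ 2 * expR (de * N i))))).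
      have -> : A^-1 * E i * (lam i * D * (de * N i) * expR (de * N i)) =
        A^-1 * D * de * (E i * (lam i * N i * expR (de * N i))) by ring.
      rewrite ler_wpM2l ?mulr_ge0 ?invr_ge0 ?(ltW A0) ?(ltW de0)//.
      by rewrite ler_wpM2l// ler_wpM2r ?expR_ge0// expr2 ler_wpM2r.
    rewrite -[leRHS]mulrA ler_wpM2l// !mulr_ge0 ?invr_ge0// ltW//.
  rewrite (ger0_norm ADK).
  have -> : A^-1 * D * de * K * H = A^-1 * D * (de * K * H) by ring.
  apply: (@le_trans _ _ (A^-1 * D * (A / 2))).
    by rewrite ler_wpM2l// mulr_ge0 ?invr_ge0// ltW.
  have An : A != 0 by rewrite gt_eqF.
  by have -> : A^-1 * D * (A / 2) = D / 2 by field.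
move=> u ur.
have := has_sumZ A^-1 (has_sumB (has_sumB (SP tde ur) (SP tde' ur)) (has_sumZ (t' u - t u) AP)).
have An : A != 0 by rewrite gt_eqF.
have -> : A^-1 * (S t u - S t' u - (t' u - t u) * A) = Phi t u - Phi t' u.
  by rewrite /Phi; field.
by apply: eq_has_sum => i; ring.
Qed.

(** Since the [E i] sum to 1, [Phi 0] is a multiple of the sum of the
    [E i * (expR (lam i * l i) - 1)], which is of order [r]; [rK] makes it at most [de / 2]. *)
Let Phi0 : pser r (de / 2) (Phi (fun=> 0)).
Proof.
have z0 : pser r de (fun _ : 'rV[R]_d => 0).
  by apply: pserW (pser_cst 0 (ltW r0)); rewrite ?normr0 ?lexx ?ltW.
have fP i : pser r (r * N i + r * N i * (r * N i) * expR (r * N i)) (fun u => expR (lam i * l i u) - 1).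
  apply: pser_exp_sub1; first exact: ltW.
  apply: pserW (pserZ (lam i) (lP i (ltW r0))); first by rewrite lexx ltW.
  by rewrite ger0_norm// mulrCA /N ler_wpM2l ?(ltW r0)// ler_wpM2l// lerDl.
have B := abs_boundedZ (A^-1 * r * (rho^-1 + K)) EH.
have rK0 : 0 <= rho^-1 + K by rewrite addr_ge0 ?invr_ge0 ?ltW.
have Ai0 : 0 <= A^-1 by rewrite invr_ge0 ltW.
apply: (pser_sum (ltW r0) (fun i => pserZ (A^-1 * E i) (fP i)) (D := de / 2)).
  apply: abs_boundedW B => [i|].
    have rN : 0 <= r * N i by rewrite mulr_ge0// ltW.
    rewrite [leRHS]ger0_norm ?mulr_ge0 ?expR_ge0// ?(ltW r0)//.
    have Ei0 : 0 <= A^-1 * E i by rewrite mulr_ge0.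
    rewrite (ger0_norm Ei0) (ger0_norm (mulr_ge0 Ei0 (pser_ge0 (fP i)))).
    have -> : A^-1 * E i * (r * N i + r * N i * (r * N i) * expR (r * N i)) =
        A^-1 * (r * (E i * N i + r * (E i * (N i ^+ 2 * expR (r * N i))))) by ring.
    have -> : A^-1 * r * (rho^-1 + K) * (E i * expR (rho * N i)) =
        A^-1 * (r * ((rho^-1 + K) * (E i * expR (rho * N i)))) by ring.
    rewrite ler_wpM2l//.
    apply: (@le_trans _ _ (r * (E i * N i + E i * (N i ^+ 2 * expR (r * N i))))).
      rewrite ler_wpM2l ?(ltW r0)// lerD2l ler_piMl//.
      exact: mulr_ge0 (E0 i) (mulr_ge0 (sqr_ge0 _) (expR_ge0 _)).
    rewrite ler_wpM2l ?(ltW r0)// mulrDl lerD//.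
    by apply: ENN; exact: le_trans rde derho.
  rewrite ger0_norm ?mulr_ge0// ?(ltW r0)//.
  have -> : A^-1 * r * (rho^-1 + K) * H = A^-1 * (r * (rho^-1 + K) * H) by ring.
  by rewrite ler_pdivrMl.
move=> u ur.
have := has_sumZ A^-1 (has_sumB (SP z0 ur) E1).
have -> : A^-1 * (S (fun=> 0) u - 1) = Phi (fun=> 0) u by rewrite /Phi add0r.
by apply: eq_has_sum => i; rewrite subr0; ring.
Qed.

Let tau n := iter n Phi (fun=> 0).

(** The increments halve from the initial [de / 2], so the iterates never leave the ball of norm
    [de] on which [lipschitz] is available. *)
Let tauP n : pser r (de * (1 - (2 ^+ n)^-1)) (tau n) /\
  pser r (de / 2 ^+ n.+1) (fun u => tau n.+1 u - tau n u).
Proof.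
elim: n => [|n [IH1 IH2]].
  rewrite expr0 invr1 subrr mulr0 expr1; split.
    by apply: pserW (pser_cst 0 (ltW r0)); rewrite ?normr0 ?lexx ?ltW.
  by apply: eq_pser Phi0 => u _; rewrite /tau/= subr0.
have t0 : (2 ^+ n : R) != 0 by rewrite expf_neq0.
have t1 m : 0 < (2 ^+ m : R)^-1 by rewrite invr_gt0 exprn_gt0.
have h : pser r (de * (1 - (2 ^+ n.+1)^-1)) (tau n.+1).
  have := pserD IH1 IH2.
  have -> : de * (1 - (2 ^+ n)^-1) + de / 2 ^+ n.+1 = de * (1 - (2 ^+ n.+1)^-1).
    by rewrite exprS; field.
  by apply: eq_pser => u _; rewrite subrKC.
split => //.
have rr : 0 <= r <= r by rewrite lexx ltW.
have w m : de * (1 - (2 ^+ m)^-1) <= de by rewrite ler_piMr ?(ltW de0)// gerBl ltW.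
have := lipschitz (pserW rr (w _) h) (pserW rr (w _) IH1) IH2.
have -> : de / 2 ^+ n.+1 / 2 = de / 2 ^+ n.+2 by rewrite [2 ^+ n.+2]exprS; field; rewrite expf_neq0.
by [].
Qed.

Lemma implicit_contraction : exists t, pser r de t /\
  forall u, `|u| <= r -> has_sum (fun i => E i * expR (lam i * (l i u - t u))) 1.
Proof.
have rr : 0 <= r <= r by rewrite lexx ltW.
have t1 m : 0 < (2 ^+ m : R)^-1 by rewrite invr_gt0 exprn_gt0.
pose t u := sumR (fun n => tau n.+1 u - tau n u).
have tcvg u : `|u| <= r -> tau n u @[n --> \oo] --> t u.
  move=> ur; have : has_sum (fun n => tau n.+1 u - tau n u) (t u).
    apply: (@sumRP _ _ _ de); apply: abs_boundedW (half_exp_abs_bounded (ltW de0)) => // n.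
    apply: le_trans (pser_le (tauP n).2 ur) _; exact: ler_norm.
  move=> /has_sum_series; apply: cvg_trans.
  rewrite (_ : series _ = fun n => tau n u)//; apply/funext => n.
  by rewrite /series/= telescope_sumr// subr0.
(* Summing the increments as power series both represents the limit as a power series and measures
   its distance to [tau n]. *)
have tail n : pser r (de / 2 ^+ n) (fun u => t u - tau n u).
  have c0 : 0 <= de / 2 ^+ n by rewrite divr_ge0 ?exprn_ge0// ltW.
  have hb := half_exp_abs_bounded c0.
  have P k : pser r (de / 2 ^+ n / 2 ^+ k.+1) (fun u => tau (n + k).+1 u - tau (n + k) u).
    have := (tauP (n + k)).2; rewrite -addnS exprD.
    by have -> : de / (2 ^+ n * 2 ^+ k.+1) = de / 2 ^+ n / 2 ^+ k.+1 by field; rewrite !expf_neq0.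
  apply: (pser_sum (ltW r0) P hb) => u ur.
  apply: (has_sum_nat (C := de / 2 ^+ n)).
    apply: abs_boundedW hb => // k.
    apply: le_trans (pser_le (P k) ur) _; exact: ler_norm.
  rewrite (_ : series _ = fun m => tau (m + n) u - tau n u); last first.
    apply/funext => m; rewrite /series/=.
    rewrite (eq_bigr (fun k => (fun k => tau (n + k) u) k.+1 - (fun k => tau (n + k) u) k)).
      by rewrite telescope_sumr// addn0 addnC.
    by move=> k _; rewrite addnS.
  apply: cvgB; last exact: cvg_cst.
  by rewrite (cvg_shiftn n (fun m => tau m u)); exact: tcvg.
have tde : pser r de t.
  have := tail 0%N; rewrite expr0 divr1; apply: eq_pser => u _; by rewrite subr0.
exists t; split => // u ur.
(* At each [u] the defect of [t] is at most |Phi t - Phi (tau n)| + |t - tau (n + 1)|, and both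
   parts are dyadically small in n. *)
suff /eqP fix_t : Phi t u == t u.
  have := SP tde ur; suff -> : S t u = 1 by [].
  have := congr1 (fun x => A * (x - t u)) fix_t; rewrite /Phi addrC addKr mulrA divff ?gt_eqF//.
  by rewrite mul1r subrr mulr0 => /eqP; rewrite subr_eq0 => /eqP.
rewrite -subr_eq0 -normr_le0; apply/ler_addgt0Pr => e e0; rewrite add0r.
have e20 : 0 < e / (2 * de) by rewrite divr_gt0// mulr_gt0.
have [n ne] : exists n, (2 ^+ n)^-1 <= e / (2 * de).
  exists (Num.bound (e / (2 * de))^-1).
  rewrite -[leRHS]invrK lef_pV2 ?posrE ?invr_gt0 ?exprn_gt0//.
  apply/ltW/(lt_trans (archi_boundP _)); first by rewrite invr_ge0 ltW.
  by rewrite -natrX ltr_nat ltn_expl.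
have w m : de * (1 - (2 ^+ m)^-1) <= de by rewrite ler_piMr ?(ltW de0)// gerBl ltW.
have h1 := pser_le (lipschitz tde (pserW rr (w _) (tauP n).1) (tail n)) ur.
have h2 := pser_le (tail n.+1) ur.
have h3 : de / 2 ^+ n <= e / 2.
  by rewrite -ler_pdivlMl// (le_trans ne)// invfM mulrA [de^-1 * _]mulrC.
have h4 : de / 2 ^+ n.+1 <= e / 2.
  apply: le_trans h3; rewrite ler_wpM2l ?(ltW de0)// lef_pV2 ?posrE ?exprn_gt0//.
  by rewrite ler_weXn2l// ler1n.
have : `|Phi t u - t u| <= `|Phi t u - Phi (tau n) u| + `|t u - tau n.+1 u|.
  rewrite (distrC (t u)); exact: ler_distD.
have : 0 <= de / 2 ^+ n by rewrite divr_ge0 ?exprn_ge0// ltW.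
move: h1 h2 h3 h4; lra.
Qed.

End contraction.

Lemma implicit_pser : exists r C t, [/\ 0 < r, pser r C t &
  forall u, `|u| <= r -> has_sum (fun i => E i * expR (lam i * (l i u - t u))) 1].
Proof.
have [K K0 ENN] := ENN_le.
have H1 : 0 < H + 1 by rewrite ltr_wpDl.
(* First [de] is made small enough for the Lipschitz constant 1/2, then [r] small relative to [de];
   [H + 1] keeps the denominators positive. *)
pose de := Num.min (rho / 2) (A / 2 / (K * (H + 1))).
have de0 : 0 < de by rewrite lt_min !divr_gt0// mulr_gt0.
have rK0 : 0 < rho^-1 + K by rewrite addr_gt0 ?invr_gt0.
pose r := Num.min (Num.min de 1) (A * (de / 2) / ((rho^-1 + K) * (H + 1))).
have r0 : 0 < r.
  rewrite lt_min; apply/andP; split; first by rewrite lt_min de0 ltr01.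
  by rewrite !(divr_gt0, mulr_gt0).
have [|||||t [tP tS]] := @implicit_contraction de r K K0 ENN de0 r0.
- by rewrite ge_min [X in X || _]ge_min lexx.
- by rewrite ge_min lexx.
- by rewrite ge_min [X in X || _]ge_min lexx orbT.
- apply: (@le_trans _ _ (de * (K * (H + 1)))).
    by rewrite -mulrA ler_wpM2l ?(ltW de0)// ler_wpM2l ?(ltW K0)// lerDl.
  by rewrite -ler_pdivlMr ?mulr_gt0// ge_min lexx orbT.
- apply: (@le_trans _ _ (r * ((rho^-1 + K) * (H + 1)))).
    by rewrite -mulrA ler_wpM2l ?(ltW r0)// ler_wpM2l ?(ltW rK0)// lerDl.
  by rewrite -ler_pdivlMr ?mulr_gt0// ge_min lexx orbT.
by exists r, de, t.
Qed.

End implicit.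

(** * Affine functions below a proper convex function *)

Section dot.
Context {R : realType} {d : nat}.
Implicit Types (a x y u v : 'rV[R]_d).

Definition dot a x : R := \sum_j a 0 j * x 0 j.

Lemma dotDr a x y : dot a (x + y) = dot a x + dot a y.
Proof. by rewrite /dot -big_split; apply: eq_bigr => j _; rewrite mxE mulrDr. Qed.

Lemma dotZr a k x : dot a (k *: x) = k * dot a x.
Proof. by rewrite /dot mulr_sumr; apply: eq_bigr => j _; rewrite mxE mulrCA. Qed.

Lemma dotDl a b x : dot (a + b) x = dot a x + dot b x.
Proof. by rewrite /dot -big_split; apply: eq_bigr => j _; rewrite mxE mulrDl. Qed.

Lemma dotZl a k x : dot (k *: a) x = k * dot a x.
Proof. by rewrite /dot mulr_sumr; apply: eq_bigr => j _; rewrite mxE mulrA. Qed.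

Lemma dotBr a x y : dot a (x - y) = dot a x - dot a y.
Proof. by rewrite dotDr -scaleN1r dotZr mulN1r. Qed.

Lemma dot0l x : dot 0 x = 0.
Proof. by rewrite /dot big1// => j _; rewrite mxE mul0r. Qed.

Lemma dot_delta j x : dot (delta_mx 0 j) x = x 0 j.
Proof.
rewrite /dot (bigD1 j)//= mxE !eqxx mul1r big1 ?addr0// => i ij.
by rewrite mxE (negbTE ij) andbF mul0r.
Qed.

Lemma rV_norm_le x (B : R) : 0 <= B -> (forall j, `|x 0 j| <= B) -> `|x| <= B.
Proof.
move=> B0 xB; rewrite [leLHS]/Num.norm/= mx_normrE; apply/bigmax_leP; split => //.
by move=> [i j] _ /=; rewrite (ord1 i).
Qed.

Lemma norm_delta_mx_le j : `|delta_mx 0 j : 'rV[R]_d| <= 1.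
Proof.
apply: rV_norm_le => // i; rewrite mxE eqxx/=.
by case: (i == j); rewrite ?normr0 ?normr1.
Qed.

End dot.

Section scalar.
Context {R : realType} {d : nat}.

Lemma scalar_dot (l : {scalar 'rV[R]_d}) (x : 'rV[R]_d) :
  l x = dot (\row_j l (delta_mx 0 j)) x.
Proof.
rewrite {1}[x]row_sum_delta linear_sum; apply: eq_bigr => j _.
by rewrite linearZ mxE mulrC.
Qed.

Lemma dot_pser (a : 'rV[R]_d) r : 0 <= r -> pser r (r * \sum_j `|a 0 j|) (dot a).
Proof.
move=> r0; rewrite mulr_sumr.
apply: pser_big => // j; rewrite mulrC; apply: pserZ; exact: pser_coord.
Qed.

Lemma analytic_at_dotD (a : 'rV[R]_d) g p : analytic_at g p ->
  analytic_at (fun x => dot a x + g x) p.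
Proof.
move=> [r [C [r0 gC]]]; exists r, (`|dot a p| + r * (\sum_j `|a 0 j|) + C); split => //.
have := pserD (pserD (pser_cst (dot a p) (ltW r0)) (dot_pser a (ltW r0))) gC.
by apply: eq_pser => u _; rewrite dotDr.
Qed.

End scalar.

(** * Support functionals and upper estimates for convex functions *)

Section convex.
Context {R : realType} {d : nat}.
Variables (U : set 'rV[R]_d) (c : 'rV[R]_d -> R).
Hypotheses (Uo : open U) (Uc : convex_set U) (cc : convex_function U c).
Implicit Types (a x y u v : 'rV[R]_d).

Lemma open_ball_rV x : U x -> exists2 r : R, 0 < r & forall y, `|y - x| < r -> U y.
Proof.
move=> Ux; have /nbhs_ballP[r r0 rU] := open_nbhs_nbhs (conj Uo Ux).
by exists r => // y yr; apply: rU; rewrite -ball_normE /= distrC.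
Qed.

Lemma convex_setP x y (t : R) : U x -> U y -> 0 <= t -> t <= 1 -> U (t *: x + (1 - t) *: y).
Proof.
move=> Ux Uy t0 t1.
have := Uc (Itv01 t0 t1) (mem_set Ux) (mem_set Uy).
by move=> /set_mem.
Qed.

Lemma convex_functionP x y (t : R) : U x -> U y -> 0 <= t -> t <= 1 ->
  c (t *: x + (1 - t) *: y) <= t * c x + (1 - t) * c y.
Proof.
move=> Ux Uy t0 t1.
exact: (cc (Itv01 t0 t1) (mem_set Ux) (mem_set Uy)).
Qed.

(* The supporting functional is found one coordinate at a time, as in the
   Hahn-Banach theorem. *)
Lemma convex_support x0 : U x0 -> exists a, forall x, U x -> c x0 + dot a (x - x0) <= c x.
Proof.
move=> U0.
suff H k : (k <= d)%N -> exists a, forall x, U x -> (forall j : 'I_d, (k <= j)%N -> x 0 j = x0 0 j) ->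
    c x0 + dot a (x - x0) <= c x.
  have [a ha] := H d (leqnn d); exists a => x Ux; apply: ha => // j.
  by rewrite leqNgt ltn_ord.
elim: k => [_|k IH kd].
  exists 0 => x Ux xx0; rewrite dot0l addr0.
  suff -> : x = x0 by [].
  by apply/rowP => j; exact: xx0.
have [a ha] := IH (ltnW kd).
pose k' := Ordinal kd; pose e : 'rV[R]_d := delta_mx 0 k'.
pose V x := U x /\ forall j : 'I_d, (k < j)%N -> x 0 j = x0 0 j.
pose t x := (x - x0) 0 k'.
pose q x := c x - c x0 - dot a (x - x0).
(* The segment from [y] to [x] meets the hyperplane t = 0 at [z], where the induction hypothesis
   applies. Hence every slope imposed from the side t < 0 is at most every slope imposed from the
   side t > 0. *)
have crossing x y : V x -> V y -> 0 < t x -> t y < 0 -> q y / t y <= q x / t x.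
  move=> [Ux Vx] [Uy Vy] tx ty.
  have txy : 0 < t x - t y by rewrite subr_gt0 (lt_trans ty).
  pose l := - t y / (t x - t y).
  have l0 : 0 <= l by rewrite divr_ge0 ?oppr_ge0// ltW.
  have l1 : l <= 1 by rewrite ler_pdivrMr// mul1r lerDr ltW.
  have lt0 : l * t x + (1 - l) * t y = 0 by rewrite /l; field; rewrite gt_eqF.
  pose z := l *: x + (1 - l) *: y.
  have zx0 : z - x0 = l *: (x - x0) + (1 - l) *: (y - x0).
    by apply/rowP => j; rewrite !mxE; ring.
  have Uz : U z by exact: convex_setP.
  have zj : forall j : 'I_d, (k <= j)%N -> z 0 j = x0 0 j.
    move=> j; rewrite leq_eqVlt => /orP[/eqP kj|kj].
      have {kj}-> : j = k' by apply/val_inj.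
      have : (z - x0) 0 k' = 0 by rewrite zx0 -lt0 /t !mxE.
      by rewrite !mxE => /eqP; rewrite subr_eq0 => /eqP.
    by rewrite !mxE Vx// Vy// -mulrDl addrC subrK mul1r.
  have := ha z Uz zj; rewrite zx0 dotDr !dotZr.
  have := convex_functionP Ux Uy l0 l1; rewrite -/z => h1 h2.
  have h : 0 <= l * q x + (1 - l) * q y by rewrite /q; move: h1 h2; lra.
  have : 0 <= (t x - t y) * (l * q x + (1 - l) * q y) by rewrite mulr_ge0// ltW.
  have -> : (t x - t y) * (l * q x + (1 - l) * q y) = t x * q y - t y * q x.
    by rewrite /l; field; rewrite gt_eqF.
  rewrite subr_ge0 => hh.
  rewrite ler_pdivlMr// mulrAC ler_ndivrMr// mulrC [leRHS]mulrC; exact: hh.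
have [r r0 rU] := open_ball_rV U0.
have Ve (s : R) : `|s| < r -> V (x0 + s *: e) /\ t (x0 + s *: e) = s.
  move=> sr; split; last by rewrite /t addrC addKr !mxE !eqxx mulr1.
  split.
    apply: rU; rewrite addrC addKr normrZ (le_lt_trans _ sr)//.
    by rewrite ler_piMr// norm_delta_mx_le.
  move=> j kj; rewrite !mxE eqxx/=.
  have -> : (j == k') = false by apply/negP => /eqP jk; rewrite jk/= ltnn in kj.
  by rewrite mulr0 addr0.
have r2 : 0 < r / 2 by rewrite divr_gt0.
have rr : `|r / 2| < r by rewrite gtr0_norm//; lra.
have rr' : `|- (r / 2)| < r by rewrite normrN.
have [Vp tp] := Ve _ rr; have [Vm tm] := Ve _ rr'.
(* Openness provides points of [V] on both sides of the hyperplane, so [L] is nonempty and bounded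
   above; its supremum is the slope in the new coordinate. *)
pose L := [set s | exists y, [/\ V y, t y < 0 & s = q y / t y]].
have supL : has_sup L.
  split; first by exists (q (x0 + - (r / 2) *: e) / t (x0 + - (r / 2) *: e)), (x0 + - (r / 2) *: e); rewrite tm oppr_lt0.
  exists (q (x0 + (r / 2) *: e) / t (x0 + (r / 2) *: e)) => _ [y [Vy ty ->]].
  by apply: crossing; rewrite ?tp.
exists (a + sup L *: e) => x Ux xx0.
have Vx : V x by split.
rewrite dotDl dotZl dot_delta -/(t x).
suff : sup L * t x <= q x by rewrite /q; lra.
have [tx|tx|tx] := ltgtP (t x) 0.
- have : q x / t x <= sup L by apply: ub_le_sup; [case: supL|exists x].
  by rewrite ler_ndivrMr.
- rewrite -ler_pdivlMr//; apply: ge_sup; first by case: supL.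
  by move=> _ [y [Vy ty ->]]; exact: crossing.
- rewrite tx mulr0 /q; suff : c x0 + dot a (x - x0) <= c x by lra.
  apply: ha => // j; rewrite leq_eqVlt => /orP[/eqP kj|kj]; last exact: xx0.
  have -> : j = k' by apply/val_inj.
  by move: tx; rewrite /t !mxE => /eqP; rewrite subr_eq0 => /eqP.
Qed.

(** Along an axis a chord bounds the rise of [c], and [x0 + u] is the midpoint of a point moved in
    one coordinate fewer and a point on an axis through [x0]. The upper estimate opens the sets of
    [open_lt_affine] and controls [c] near p in [solution_margin]. *)
Lemma convex_usc x0 : U x0 -> exists C r : R, [/\ 0 <= C, 0 < r &
  forall x, `|x - x0| <= r -> U x /\ c x <= c x0 + C * `|x - x0|].
Proof.
move=> U0; have [r0 r00 rU] := open_ball_rV U0.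
suff H k : (k <= d)%N -> exists C r : R, [/\ 0 <= C, 0 < r &
    forall u, (forall j : 'I_d, (k <= j)%N -> u 0 j = 0) -> `|u| <= r ->
    U (x0 + u) /\ c (x0 + u) <= c x0 + C * `|u|].
  have [C [r [C0 rp h]]] := H d (leqnn d); exists C, r; split => // x xr.
  have [|Ux cx] := h (x - x0) _ xr; first by move=> j; rewrite leqNgt ltn_ord.
  by rewrite subrKC in Ux cx.
elim: k => [_|k IH kd].
  exists 0, 1; split => // u u0 _; have -> : u = 0 by apply/rowP => j; rewrite u0// mxE.
  by rewrite addr0 mul0r addr0.
have [C [r [C0 rp h]]] := IH (ltnW kd).
pose k' := Ordinal kd; pose e : 'rV[R]_d := delta_mx 0 k'.
pose s0 := r0 / 2; have s00 : 0 < s0 by rewrite divr_gt0.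
have Us (s : R) : `|s| <= s0 -> U (x0 + s *: e).
  move=> ss; apply: rU; rewrite addrC addKr normrZ.
  apply: (@le_lt_trans _ _ s0); last by rewrite /s0; lra.
  by rewrite (le_trans _ ss)// ler_piMr// norm_delta_mx_le.
pose B := `|c (x0 + s0 *: e) - c x0| + `|c (x0 - s0 *: e) - c x0|.
have Bs (s : R) : `|s| <= s0 -> c (x0 + s *: e) <= c x0 + B / s0 * `|s|.
  move=> ss; pose l := `|s| / s0.
  have l0 : 0 <= l by rewrite divr_ge0// ltW.
  have l1 : l <= 1 by rewrite ler_pdivrMr// mul1r.
  have key (z : 'rV[R]_d) : U z -> c z - c x0 <= B -> x0 + s *: e = l *: z + (1 - l) *: x0 ->
      c (x0 + s *: e) <= c x0 + B / s0 * `|s|.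
    move=> Uz zB ->; apply: le_trans (convex_functionP Uz U0 l0 l1) _.
    have -> : B / s0 * `|s| = l * B by rewrite /l; ring.
    have := ler_wpM2l l0 zB; lra.
  have ls : l * s0 = `|s| by rewrite /l divfK// gt_eqF.
  have [s_ge0|s_lt0] := leP 0 s.
    apply: (key (x0 + s0 *: e)).
    - by apply: Us; rewrite gtr0_norm.
    - by rewrite /B (le_trans (ler_norm _))// lerDl.
    - rewrite scalerDr scalerBl scale1r scalerA ls ger0_norm//.
      by rewrite (addrC (l *: x0)) -addrA subrKC addrC.
  apply: (key (x0 - s0 *: e)).
  - by rewrite -scaleNr; apply: Us; rewrite normrN gtr0_norm.
  - by rewrite /B (le_trans (ler_norm _))// lerDr.
  - rewrite scalerBr scalerBl scale1r scalerA ls ltr0_norm// scaleNr opprK.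
    by rewrite (addrC (l *: x0)) -addrA subrKC addrC.
exists (C + B / s0), (Num.min (r / 2) (s0 / 2)); split.
- by rewrite addr_ge0// divr_ge0 ?addr_ge0// ltW.
- by rewrite lt_min !divr_gt0.
move=> u u0; rewrite le_min => /andP[ur us].
pose u' : 'rV[R]_d := \row_j if (j < k)%N then u 0 j else 0.
have u'u : `|u'| <= `|u|.
  by apply: rV_norm_le => // j; rewrite mxE; case: ifP; rewrite ?normr0// rV_norm_coord.
have ku : `|u 0 k'| <= `|u| := rV_norm_coord u k'.
have udec : u = u' + u 0 k' *: e.
  apply/rowP => j; rewrite !mxE eqxx/=.
  have [jk|kj|jk] := ltngtP j k.
  - have -> : (j == k') = false by apply/negP => /eqP jk'; rewrite jk'/= ltnn in jk.
    by rewrite mulr0 addr0.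
  - rewrite u0//; have -> : (j == k') = false by apply/negP => /eqP jk'; rewrite jk'/= ltnn in kj.
    by rewrite mulr0 addr0.
  - have -> : j = k' by apply/val_inj.
    by rewrite eqxx mulr1 add0r.
have mid : x0 + u = 2^-1 *: (x0 + 2 *: u') + (1 - 2^-1) *: (x0 + (2 * u 0 k') *: e).
  have -> : 1 - 2^-1 = 2^-1 :> R by lra.
  rewrite !scalerDr !scalerA mulrA mulVf// mul1r scale1r addrACA -scalerDl -udec.
  by rewrite -[X in X + _]scale1r; congr (_ *: _ + _); lra.
have [||Uu' cu'] := h (2 *: u').
- by move=> j kj; rewrite !mxE ltnNge kj/= mulr0.
- by rewrite normrZ ger0_norm//; move: ur u'u; lra.
have ss : `|2 * u 0 k'| <= s0 by rewrite normrM ger0_norm//; move: us ku; lra.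
have h0 : 0 <= 2^-1 :> R by rewrite invr_ge0.
have h1 : 2^-1 <= 1 :> R by rewrite invf_le1// ler1n.
rewrite mid; split; first exact: (convex_setP Uu' (Us _ ss) h0 h1).
apply: le_trans (convex_functionP Uu' (Us _ ss) h0 h1) _.
have := Bs _ ss; move: cu'; rewrite normrZ normrM (ger0_norm (ler0n _ 2)) => h2 h3.
have B0 : 0 <= B / s0 by rewrite divr_ge0 ?addr_ge0// ltW.
have := ler_wpM2l C0 u'u; have := ler_wpM2l B0 ku.
lra.
Qed.


Lemma open_lt_affine a (k : R) : open [set x | U x /\ c x < k + dot a x].
Proof.
rewrite openE => x0 [/= U0 cx0].
have [C [r [C0 r0 h]]] := convex_usc U0.
pose D := C + \sum_j `|a 0 j|.
have D0 : 0 <= D by rewrite addr_ge0// sumr_ge0.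
pose g := k + dot a x0 - c x0.
have g0 : 0 < g by rewrite subr_gt0.
apply/nbhs_ballP; exists (Num.min r (g / (D + 1))) => /=.
  by rewrite lt_min r0 divr_gt0// ltr_wpDl.
move=> x; rewrite -ball_normE /= distrC lt_min => /andP[xr xg].
have [Ux cx] := h x (ltW xr); split => //.
have dx : dot a (x0 - x) <= (\sum_j `|a 0 j|) * `|x - x0|.
  rewrite mulr_suml; apply: ler_sum => j _.
  apply: le_trans (ler_norm _) _; rewrite normrM ler_wpM2l// distrC.
  exact: rV_norm_coord.
have : (D + 1) * `|x - x0| < g by rewrite mulrC -ltr_pdivlMr// ltr_wpDl.
move: dx cx; rewrite dotBr /g /D; have := normr_ge0 (x - x0); nra.
Qed.

End convex.

(** * Construction of the affine family from properness *)

Section affine_family.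
Context {R : realType} {d : nat}.
Variables (U : set 'rV[R]_d) (c : 'rV[R]_d -> R) (a0 : R) (b : \bar R) (eps : 'rV[R]_d -> R).
Hypotheses (Uo : open U) (Uc : convex_set U) (cc : convex_function U c).
Hypotheses (ab : (a0%:E < b)%E) (cP : proper_on U a0 b c).
Hypotheses (epsc : {within U, continuous eps}) (eps0 : forall x, U x -> 0 < eps x).
Implicit Types (x y u v : 'rV[R]_d) (m : 'rV[R]_d * R).

Definition aff m x := m.2 + dot m.1 x.

(** The first condition yields the tail bound of the family, the second a finite rate, and the third
    keeps the values of the function below [b], where sublevel sets are compact. *)
Definition admissible (s : R) m :=
  [/\ forall x, U x -> aff m x <= c x + s,
      exists2 eta : R, 0 < eta & forall x, U x -> aff m x + eta <= c x + eps x &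
      forall x, U x -> ((aff m x)%:E < b)%E].

Lemma lte_EFin_dense (x : R) : (x%:E < b)%E -> exists2 y : R, x < y & (y%:E < b)%E.
Proof.
case: b => [r|_|//].
  by rewrite lte_fin => xr; exists ((x + r) / 2); rewrite ?lte_fin; lra.
by exists (x + 1); rewrite ?ltry// ltrDl.
Qed.

Lemma eps_min_on (be : R) : a0 <= be -> (be%:E < b)%E ->
  exists2 e : R, 0 < e & forall x, U x -> c x <= be -> e <= eps x.
Proof.
move=> abe beb; pose K := [set x | U x /\ a0 <= c x <= be].
have KU : K `<=` U by move=> x [].
have [K0|/set0P/negP/negPn/eqP K0] := pselect (K !=set0); last first.
  exists 1 => // x Ux cx; suff : K x by rewrite K0.
  by split => //; rewrite cx; have [/(_ _ Ux)[-> _] _] := cP.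
have cK : compact K by have [_] := cP; exact.
have [x0 Kx0 h] := compact_EVT_min K0 cK (continuous_subspaceW KU epsc).
exists (eps x0); first by apply: eps0; case: (set_mem Kx0).
move=> x Ux cx; apply: h; apply/mem_set; split => //.
by rewrite cx; have [/(_ _ Ux)[-> _] _] := cP.
Qed.

(* The support plane l at x0 is tilted to (1 - th) l + th b1 with
   c x0 < b1 < b: it rises above c near x0, but by properness it stays
   uniformly below c away from a compact set. *)
Lemma tilted_support x0 (s : R) : U x0 -> 0 < s ->
  exists m, admissible s m /\ c x0 < aff m x0.
Proof.
move=> U0 s0; have [cU cK] := cP.
have [ac cb] := cU _ U0.
have [be cbe beb] := lte_EFin_dense cb.
have [e e0 he] := eps_min_on (ltW (le_lt_trans ac cbe)) beb.
have [p hp] := convex_support Uo Uc cc U0.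
pose b1 := (c x0 + be) / 2.
have b1a : 0 < b1 - a0 by rewrite /b1; move: ac cbe; lra.
(* As c >= a0, tilting exceeds [c] by at most [th * (b1 - a0)]: at most [s] everywhere, and at most
   [e / 2] where c <= be, which leaves a margin [e / 2]. Where c > be the tilted plane is below [c]
   by at least [th * (be - b1)]. *)
pose th := Num.min (2^-1) (Num.min s (e / 2) / (b1 - a0)).
have th0 : 0 < th by rewrite lt_min invr_gt0 ltr0n/= divr_gt0// lt_min s0 divr_gt0.
have th1 : th <= 2^-1 by rewrite ge_min lexx.
have ths : th * (b1 - a0) <= s /\ th * (b1 - a0) <= e / 2.
  have : th * (b1 - a0) <= Num.min s (e / 2) by rewrite -ler_pdivlMr// ge_min lexx orbT.
  by rewrite le_min => /andP[].
case: ths => ths the.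
exists ((1 - th) *: p, (1 - th) * (c x0 - dot p x0) + th * b1).
have affE x : aff ((1 - th) *: p, (1 - th) * (c x0 - dot p x0) + th * b1) x =
    (1 - th) * (c x0 + dot p (x - x0)) + th * b1.
  by rewrite /aff/= dotZl dotBr; ring.
have t1 : 0 <= 1 - th by move: th1; lra.
have affle x : U x -> (1 - th) * (c x0 + dot p (x - x0)) + th * b1 <= (1 - th) * c x + th * b1.
  by move=> Ux; rewrite lerD2r ler_wpM2l//; exact: hp.
have thc x : U x -> th * a0 <= th * c x by move=> /cU[? _]; rewrite ler_wpM2l// ltW.
split; last by rewrite affE subrr -(scale0r (0 : 'rV[R]_d)) dotZr mul0r addr0 /b1; nra.
split.
- by move=> x Ux; rewrite affE; have := affle _ Ux; have := thc _ Ux; move: ths; lra.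
- exists (Num.min (th * (be - b1)) (e / 2)).
    by rewrite lt_min divr_gt0// andbT mulr_gt0// /b1; move: cbe; lra.
  move=> x Ux; rewrite affE; have := affle _ Ux; have := thc _ Ux.
  have [cx|cx] := leP (c x) be.
    have := he _ Ux cx; have : Num.min (th * (be - b1)) (e / 2) <= e / 2 by rewrite ge_min lexx orbT.
    move: the; lra.
  have := eps0 Ux; have : Num.min (th * (be - b1)) (e / 2) <= th * (be - b1) by rewrite ge_min lexx.
  nra.
- move=> x Ux; rewrite affE; apply: (@le_lt_trans _ _ ((1 - th) * c x + th * b1)%:E).
    by rewrite lee_fin; exact: affle.
  have [_ cxb] := cU _ Ux.
  apply: (@le_lt_trans _ _ (Num.max (c x) be)%:E); last by rewrite EFin_max gt_max cxb.
  rewrite lee_fin; have : c x <= Num.max (c x) be by rewrite le_max lexx.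
  have : be <= Num.max (c x) be by rewrite le_max lexx orbT.
  move: (Num.max _ _) => M; rewrite /b1; move: cbe; nra.
Qed.

(** This constant pads the enumeration of the family and also puts the slope 0 into it, a reference
    for [slopes_differ]. *)
Lemma admissible_cst (s : R) : 0 < s -> admissible s (0, a0 - 1).
Proof.
move=> s0; have [cU cK] := cP; split.
- by move=> x Ux; rewrite /aff dot0l/=; have [? _] := cU _ Ux; lra.
- exists 1 => // x Ux; rewrite /aff dot0l/=; have [? _] := cU _ Ux; have := eps0 Ux; lra.
- move=> x Ux; rewrite /aff dot0l/=; apply: lt_trans ab; rewrite lte_fin; lra.
Qed.

Lemma admissible_finite_cover (be s : R) : 0 < s -> a0 <= be -> (be%:E < b)%E ->
  exists ms : seq ('rV[R]_d * R), (forall m, m \in ms -> admissible s m) /\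
    forall x, U x -> c x <= be -> exists2 m, m \in ms & c x < aff m x.
Proof.
move=> s0 abe beb; have [cU cK] := cP.
have := cK be abe beb; rewrite compact_cover.
move=> /(_ _ [set m | admissible s m] (fun m => [set x | U x /\ c x < m.2 + dot m.1 x])).
case.
- by move=> m _; exact: open_lt_affine.
- move=> x [Ux _]; have [m [am xm]] := tilted_support Ux s0.
  by exists m.
move=> D Dadm cov; exists (enum_fset D); split => [m /Dadm /set_mem//|x Ux cx].
have [|m mD [_ xm]] := cov x; first by split => //; rewrite cx; have [-> _] := cU _ Ux.
by exists m.
Qed.

(** Stage n treats the rational level encoded by n: finitely many functions below c + 2^-n cover
    that sublevel set. Rational levels below [b] exhaust U, and finiteness of the stages leaves only
    late ones, apart from the default, among large indices. *)
Lemma affine_family : exists m : nat -> 'rV[R]_d * R,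
  [/\ forall x, U x -> exists i, c x < aff (m i) x,
      forall s : R, 0 < s -> exists i0, forall i, (i0 <= i)%N -> forall x, U x -> aff (m i) x <= c x + s,
      forall i, exists2 eta : R, 0 < eta & forall x, U x -> aff (m i) x + eta <= c x + eps x,
      forall i x, U x -> ((aff (m i) x)%:E < b)%E &
      exists i, m i = (0, a0 - 1)].
Proof.
have [cU cK] := cP.
have stage (n : nat) : exists ms : seq ('rV[R]_d * R),
    (forall m, m \in ms -> admissible (2 ^- n) m) /\
    forall q : rat, n = choice.pickle q -> a0 <= ratr q -> ((ratr q : R)%:E < b)%E ->
    forall x, U x -> c x <= ratr q -> exists2 m, m \in ms & c x < aff m x.
  have n0 : 0 < (2 : R) ^- n by rewrite invr_gt0 exprn_gt0.
  have [[q [nq aq qb]]|nex] := pselect (exists q : rat, [/\ n = choice.pickle q, a0 <= ratr q & ((ratr q : R)%:E < b)%E]).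
    have [ms [h1 h2]] := admissible_finite_cover n0 aq qb.
    exists ms; split => // q' nq' aq' qb'.
    suff -> : q' = q by [].
    by apply: (pcan_inj (@choice.pickleK rat)); rewrite -nq -nq'.
  by exists [::]; split => // q nq aq qb; exfalso; apply: nex; exists q.
have {stage}[ms hms] := choice stage.
pose dm : 'rV[R]_d * R := (0, a0 - 1).
pose mm (p : nat * nat) := nth dm (ms p.1) p.2.
pose m (i : nat) := if choice.pickle_inv i is Some p then mm p else dm.
have mmP p : mm p = dm \/ (p.2 < size (ms p.1))%N /\ mm p \in ms p.1.
  have [h|h] := ltnP p.2 (size (ms p.1)); first by right; split => //; exact: mem_nth.
  by left; rewrite /mm nth_default.
have adm i : exists2 s : R, 0 < s & admissible s (m i).
  have s1 : 0 < (1 : R) by [].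
  rewrite /m; case: choice.pickle_inv => [p|]; last by exists 1 => //; exact: admissible_cst.
  case: (mmP p) => [->|[_ pm]]; first by exists 1 => //; exact: admissible_cst.
  by exists (2 ^- p.1); [rewrite invr_gt0 exprn_gt0|exact: (hms _).1].
exists m; split.
- move=> x Ux; have [acx cb] := cU _ Ux; have [be cbe beb] := lte_EFin_dense cb.
  have [q /itvP qI] := rat_in_itvoo cbe.
  have qb : ((ratr q : R)%:E < b)%E by apply: le_lt_trans beb; rewrite lee_fin qI.
  have cq : c x <= ratr q by rewrite qI.
  have [m' m'in xm'] := (hms (choice.pickle q)).2 q erefl (le_trans acx cq) qb x Ux cq.
  exists (choice.pickle (choice.pickle q, index m' (ms (choice.pickle q)))).
  by rewrite /m choice.pickleK_inv /mm/= nth_index.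
- move=> s s0.
  pose n0 := Num.bound s^-1.
  have n0s n : (n0 <= n)%N -> (2 : R) ^- n <= s.
    move=> nn; rewrite -[leRHS]invrK lef_pV2 ?posrE ?invr_gt0 ?exprn_gt0//.
    apply/ltW/(lt_le_trans (archi_boundP _)); first by rewrite invr_ge0 ltW.
    by rewrite -natrX ler_nat (leq_trans nn)// ltnW// ltn_expl.
  (* One more than the largest code of an entry in a stage before [n0]. *)
  pose i0 := \max_(n < n0) \max_(j < size (ms n)) (choice.pickle (n : nat, j : nat)).+1.
  exists i0 => i ii x Ux.
  have dle : aff dm x <= c x + s by have [h _ _] := admissible_cst s0; exact: h.
  rewrite /m; case E : (choice.pickle_inv i) => [p|//].
  case: (mmP p) => [->//|[psz pm]].
  have [pn|pn] := leqP n0 p.1.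
    have [h _ _] := (hms p.1).1 _ pm.
    by rewrite (le_trans (h _ Ux))// lerD2l n0s.
  have := @choice.pickle_invK (nat * nat)%type i; rewrite E/= => pi.
  have := leq_trans (leq_bigmax (Ordinal psz)) (leq_bigmax (F := fun n : 'I_n0 => \max_(j < size (ms n)) (choice.pickle (n : nat, j : nat)).+1) (Ordinal pn)).
  by rewrite /= -surjective_pairing pi ltnNge ii.
- by move=> i; have [s _ []] := adm i.
- by move=> i; have [s _ []] := adm i.
(* A position just past the end of the list of stage 0 decodes to the default [dm]. *)
- exists (choice.pickle (0%N, size (ms 0%N))).
  by rewrite /m choice.pickleK_inv /mm/= nth_default.
Qed.

End affine_family.

(** * The approximating function *)

Section exponential_sums.
Context {R : realType}.

Lemma expR_geometric_abs_bounded (lam z : nat -> R) (mu : R) : 0 < mu ->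
  (forall i, i.+1%:R <= lam i) -> (forall i, z i <= - mu) ->
  abs_bounded (fun i => expR (lam i * z i)) (expR (- mu) / (1 - expR (- mu))).
Proof.
move=> mu0 lami zi; set q := expR (- mu).
have q0 : 0 < q by exact: expR_gt0.
have q1 : q < 1 by rewrite expR_lt1 oppr_lt0.
apply: nneg_series_abs_bounded => [i|n]; first exact: expR_ge0.
apply: (@le_trans _ _ (\sum_(0 <= i < n) q ^+ i.+1)).
  apply: ler_sum => i _; rewrite /q -expRM_natl ler_expR.
  have l0 : 0 <= lam i by apply: le_trans (lami i).
  apply: (@le_trans _ _ (lam i * - mu)); first by rewrite ler_wpM2l.
  by rewrite ler_wnM2r// oppr_le0 ltW.
suff -> : \sum_(0 <= i < n) q ^+ i.+1 = q / (1 - q) * (1 - q ^+ n).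
  by rewrite ler_piMr ?divr_ge0 ?subr_ge0 ?(ltW q0) ?(ltW q1)// gerBl exprn_ge0// ltW.
elim: n => [|n IH]; first by rewrite big_nil expr0 subrr mulr0.
by rewrite big_nat_recr//= IH !exprS; field; rewrite subr_eq0 gt_eqF.
Qed.

Lemma pos_lower_bound (s : seq R) : all (fun x => 0 < x) s ->
  exists2 h : R, 0 < h & forall x, x \in s -> h <= x.
Proof.
elim: s => [|y s IH] /=; first by exists 1.
case/andP=> y0 /IH[h h0 hs]; exists (Num.min y h); first by rewrite lt_min y0.
move=> x; rewrite inE => /predU1P[->|/hs xh]; first by rewrite ge_min lexx.
by rewrite ge_min xh orbT.
Qed.

Lemma expR_convexB (x y : R) : expR x - expR y <= (x - y) * expR x.
Proof.
have h := expR_ge1Dx (y - x).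
have -> : expR y = expR x * expR (y - x) by rewrite -expRD addrC subrK.
have := ler_wpM2l (expR_ge0 x) h; lra.
Qed.

(** The excess over 2 is the square of exp(y/2) - exp(-y/2). It supplies the quadratic gain in
    [derive2_gt0]. *)
Lemma cosh_ge (y : R) : 2 + (y / 2) ^+ 2 <= expR y + expR (- y).
Proof.
wlog y0 : y / 0 <= y => [H|].
  have [|y0] := leP 0 y; first exact: H.
  have := H (- y); rewrite oppr_ge0 (ltW y0) opprK mulNr sqrrN => /(_ isT).
  by rewrite [leRHS]addrC.
set a := expR (y / 2); set b := expR (- (y / 2)).
have aE : expR y = a * a by rewrite -expRD -splitr.
have bE : expR (- y) = b * b by rewrite -expRD -opprD -splitr.
have ab : a * b = 1 by rewrite -expRD subrr expR0.
have a1 : 1 + y / 2 <= a by exact: expR_ge1Dx.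
have b1 : b <= 1 by rewrite expR_le1 oppr_le0 divr_ge0.
have h : y / 2 <= a - b by lra.
have : (y / 2) ^+ 2 <= (a - b) ^+ 2 by rewrite lerXn2r ?nnegrE ?divr_ge0// (le_trans _ h)// divr_ge0.
rewrite aE bE; nra.
Qed.

End exponential_sums.

Section exp_term.
Context {R : realType} {d : nat}.

Definition exp_term (m : nat -> 'rV[R]_d * R) (lam : nat -> R) (x : 'rV[R]_d) (t : R) i :=
  expR (lam i * (aff (m i) x - t)).

End exp_term.

Section approximant.
Context {R : realType} {d : nat}.
Variables (U : set 'rV[R]_d) (c : 'rV[R]_d -> R) (a0 : R) (b : \bar R) (eps : 'rV[R]_d -> R).
Hypotheses (Uo : open U) (Uc : convex_set U) (cc : convex_function U c).
Hypothesis cP : proper_on U a0 b c.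
Variable m : nat -> 'rV[R]_d * R.
Hypothesis m_above : forall x, U x -> exists i, c x < aff (m i) x.
Hypothesis m_tail : forall s : R, 0 < s -> exists i0, forall i, (i0 <= i)%N ->
  forall x, U x -> aff (m i) x <= c x + s.
Hypothesis m_gap : forall i, exists2 eta : R, 0 < eta &
  forall x, U x -> aff (m i) x + eta <= c x + eps x.
Hypothesis m_lt : forall i x, U x -> ((aff (m i) x)%:E < b)%E.
Hypothesis m_cst : exists i, m i = (0, a0 - 1).
Implicit Types (x y u v p : 'rV[R]_d).

Lemma affD q x u : aff q (x + u) = aff q x + dot q.1 u.
Proof. by rewrite /aff dotDr addrA. Qed.

Lemma exists_rates : exists lam : nat -> R, (forall i, i.+1%:R <= lam i) /\
  forall i x, U x -> expR (lam i * (aff (m i) x - (c x + eps x))) <= 1 / 2 ^+ i.+1.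
Proof.
have /choice[eta heta] : forall i, exists e : R, 0 < e /\ forall x, U x -> aff (m i) x + e <= c x + eps x.
  by move=> i; have [e e0 h] := m_gap i; exists e.
have lam0 i : 0 <= i.+1%:R * (1 + (eta i)^-1).
  by rewrite mulr_ge0// addr_ge0// invr_ge0 ltW//; case: (heta i).
(* The part with the inverse margin makes [lam i * eta i] at least i + 1, and exp(-1) <= 1/2 does
   the rest; the summand 1 secures the linear growth needed for geometric convergence. *)
exists (fun i => i.+1%:R * (1 + (eta i)^-1)); split => [i|i x Ux].
  have [e0 _] := heta i.
  by rewrite ler_peMr// lerDl invr_ge0 ltW.
have [e0 h] := heta i.
apply: (@le_trans _ _ (expR (i.+1%:R * -1))).
  rewrite ler_expR; apply: (@le_trans _ _ (i.+1%:R * (1 + (eta i)^-1) * - eta i)).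
    by rewrite ler_wpM2l//; have := h _ Ux; lra.
  rewrite -mulrA ler_wpM2l// mulrDl mul1r mulrN mulVf ?gt_eqF//; lra.
rewrite expRM_natl expRN exprVn div1r lef_pV2 ?posrE ?exprn_gt0 ?expR_gt0//.
rewrite lerXn2r ?nnegrE ?expR_ge0//.
have := expR_ge1Dx (1 : R); lra.
Qed.

Variable lam : nat -> R.
Hypothesis lam_ge : forall i, i.+1%:R <= lam i.
Hypothesis lam_eps : forall i x, U x -> expR (lam i * (aff (m i) x - (c x + eps x))) <= 1 / 2 ^+ i.+1.

Let lam1 i : 1 <= lam i.
Proof. by apply: le_trans (lam_ge i); rewrite ler1n. Qed.

Let lam0 i : 0 < lam i. Proof. exact: lt_le_trans (lam1 i). Qed.

Local Notation G := (exp_term m lam).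

(** Once some [m k] exceeds [c] at x, the tail bound with s equal to this excess leaves finitely
    many competitors. *)
Lemma max_attained x : U x -> exists i, c x < aff (m i) x /\ forall j, aff (m j) x <= aff (m i) x.
Proof.
move=> Ux; have [k xk] := m_above Ux.
have [i0 hi0] := m_tail (s := aff (m k) x - c x) ltac:(by rewrite subr_gt0).
pose N := (maxn k i0).
have kN : (k < N.+1)%N by rewrite ltnS leq_maxl.
have [i _ hi] := @arg_maxP _ R 'I_N.+1 (Ordinal kN) xpredT (fun i => aff (m i) x) isT.
exists i; have ki := hi (Ordinal kN) isT; split; first exact: lt_le_trans ki.
move=> j; have [ji|ij] := leqP i0 j.
  apply: le_trans (hi0 j ji x Ux) _; rewrite addrC subrK; exact: ki.
have jN : (j < N.+1)%N by rewrite ltnS (leq_trans (ltnW ij))// leq_maxr.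
exact: (hi (Ordinal jN) isT).
Qed.

(** All rates are at least 1, so raising t to t' multiplies every term by at most exp(t - t') <
    1. *)
Lemma exp_term_root_unique x (t t' : R) : has_sum (G x t) 1 -> has_sum (G x t') 1 -> t = t'.
Proof.
wlog tt' : t t' / t < t' => [H ht ht'|].
  by have [/H|/H|//] := ltgtP t t'; [exact|move=> /(_ ht' ht)].
move=> ht ht'; exfalso.
have : 1 <= expR (t - t') * 1.
  apply: has_sum_le ht' (has_sumZ (expR (t - t')) ht) => i.
  rewrite /exp_term -expRD ler_expR.
  have : (lam i - 1) * (t - t') <= 0 by rewrite mulr_ge0_le0// ?subr_ge0// subr_le0 ltW.
  lra.
rewrite mulr1 leNgt; apply/negP; rewrite negbK.
by rewrite expR_lt1 subr_lt0.
Qed.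

Lemma exp_term_bounded x (t mu : R) : 0 < mu -> (forall i, aff (m i) x <= t - mu) ->
  abs_bounded (G x t) (expR (- mu) / (1 - expR (- mu))).
Proof. by move=> mu0 h; apply: expR_geometric_abs_bounded => // i; have := h i; lra. Qed.

(** Half of the gap [mu] pays for the factor [lam i]. *)
Lemma rate_exp_term_bounded x (t mu : R) : 0 < mu -> (forall i, aff (m i) x <= t - mu) ->
  exists C, abs_bounded (fun i => lam i * G x t i) C.
Proof.
move=> mu0 hmu.
have mu20 : 0 < mu / 2 by rewrite divr_gt0.
have := abs_boundedZ (2 / mu) (exp_term_bounded (x := x) (t := t - mu / 2) mu20 _).
move=> H; eexists; apply: abs_boundedW (H _) => // i; last by have := hmu i; lra.
rewrite !ger0_norm ?mulr_ge0 ?expR_ge0 ?invr_ge0 ?(ltW mu0) ?(ltW (lam0 i))//.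
have -> : G x (t - mu / 2) i = expR (mu / 2 * lam i) * G x t i.
  by rewrite /exp_term -expRD; congr expR; ring.
rewrite mulrA ler_wpM2r ?expR_ge0//.
have -> : 2 / mu = (mu / 2)^-1 by rewrite invf_div.
rewrite ler_pdivlMl//; apply: le_trans (expR_ge1Dx _); lra.
Qed.

(** [Num.max t t1] freezes the sum below [t1], where convergence is not guaranteed, so that
    continuity holds on the whole line. A bound for the sum of the [lam i * G x t1 i] is a Lipschitz
    constant. *)
Lemma sumR_exp_term_continuous x (t1 : R) :
  (exists2 mu, 0 < mu & forall i, aff (m i) x <= t1 - mu) ->
  continuous (fun t => sumR (G x (Num.max t t1))).
Proof.
move=> [mu mu0 hmu].
have [C bd1] := rate_exp_term_bounded mu0 hmu.
have C0 := abs_bounded_ge0 bd1.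
have bd t : t1 <= t -> abs_bounded (fun i => lam i * G x t i) C.
  move=> t1t; apply: abs_boundedW bd1 => // i.
  rewrite !normrM ler_wpM2l// !ger0_norm ?expR_ge0// ler_expR.
  by rewrite ler_wpM2l ?(ltW (lam0 i))//; lra.
have bd0 t : t1 <= t -> has_sum (G x t) (sumR (G x t)).
  by move=> t1t; apply: sumRP (exp_term_bounded mu0 _) => i; have := hmu i; lra.
have lip t t' : t1 <= t -> t <= t' -> `|sumR (G x t) - sumR (G x t')| <= (t' - t) * C.
  move=> t1t tt'; have t1t' := le_trans t1t tt'.
  have ht := abs_boundedZ (t' - t) (bd t t1t); rewrite ger0_norm ?subr_ge0// in ht.
  apply: has_sum_norm_le (has_sumB (bd0 _ t1t) (bd0 _ t1t')).
  apply: abs_boundedW ht => // i.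
  rewrite [leRHS]ger0_norm ?mulr_ge0 ?subr_ge0 ?expR_ge0 ?(ltW (lam0 i))//.
  rewrite ger0_norm; last first.
    by rewrite subr_ge0 ler_expR ler_wpM2l ?(ltW (lam0 i))//; lra.
  apply: le_trans (expR_convexB _ _) _; rewrite mulrA ler_wpM2r ?expR_ge0//.
  by rewrite le_eqVlt; apply/orP; left; apply/eqP; ring.
move=> t0; apply/(@cvgrPdist_le _ R^o) => e e0.
near=> t.
have te : `|t0 - t| <= e / (C + 1).
  near: t; apply: (@cvgr_dist_le _ _ _ _ _ id t0); first exact: cvg_id.
  by rewrite divr_gt0// ltr_wpDl.
have key s s' : `|s - s'| <= e / (C + 1) -> s <= s' ->
    `|sumR (G x (Num.max s t1)) - sumR (G x (Num.max s' t1))| <= e.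
  move=> ss ss'; apply: le_trans (lip _ _ _ _) _.
  - by rewrite le_max lexx orbT.
  - by rewrite ge_max !le_max ss' lexx orbT.
  have : Num.max s' t1 - Num.max s t1 <= e / (C + 1).
    apply: le_trans ss; rewrite distrC ger0_norm ?subr_ge0//.
    by rewrite /Num.max; case: ltP => ?; case: ltP => ?; lra.
  rewrite ler_pdivlMr ?ltr_wpDl// => h.
  have : 0 <= Num.max s' t1 - Num.max s t1.
    by rewrite subr_ge0 ge_max !le_max ss' lexx orbT.
  move: h; move: (_ - _) => D; nra.
have [tt|/ltW tt] := leP t0 t; first exact: key.
by rewrite distrC; apply: key => //; rewrite distrC.
Unshelve. all: by end_near. Qed.

(** Intermediate values on an interval from slightly above the maximum M of the [aff (m i) x] up to
    c + eps, where the rates bound the terms by 2^-(i+1). Starting strictly above M gives both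
    summability and the strict inequalities. *)
Lemma exp_term_root x : U x -> exists t : R,
  [/\ has_sum (G x t) 1, forall i, aff (m i) x < t & c x < t <= c x + eps x].
Proof.
move=> Ux; have [i [xi hi]] := max_attained Ux.
set M := aff (m i) x in xi hi.
pose T := c x + eps x.
have [eta eta0 heta] := m_gap i.
have MT : M < T by have := heta _ Ux; rewrite -/M /T; lra.
(* Near M the terms i and j := i + 1 already sum to more than 1. *)
pose j := i.+1.
have [s s0 hs] : exists2 s : R, 0 < s & 1 <= expR (- (lam i * s)) + expR (lam j * (aff (m j) x - M - s)).
  pose k := expR (lam j * (aff (m j) x - M - 1)).
  have k0 : 0 < k by exact: expR_gt0.
  (* s <= 1 keeps the second term at least [k], and [lam i * s <= k] keeps the first at least 1 -
     k. *)
  exists (Num.min 1 (k / lam i)); first by rewrite lt_min ltr01 divr_gt0.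
  set s := Num.min _ _.
  have s1 : s <= 1 by rewrite ge_min lexx.
  have sk : lam i * s <= k by rewrite mulrC -ler_pdivlMr// ge_min lexx orbT.
  have h1 := expR_ge1Dx (- (lam i * s)).
  have h2 : k <= expR (lam j * (aff (m j) x - M - s)).
    by rewrite /k ler_expR ler_wpM2l ?(ltW (lam0 j))//; lra.
  lra.
pose tL := Num.min (M + s) ((M + T) / 2).
have tLM : M < tL by rewrite lt_min ltrDl s0/=; lra.
have tLT : tL <= T.
  by apply: (@le_trans _ _ ((M + T) / 2)); [rewrite ge_min lexx orbT|lra].
have tLs : tL <= M + s by rewrite ge_min lexx.
have hmu : exists2 mu, 0 < mu & forall k, aff (m k) x <= tL - mu.
  by exists (tL - M); [rewrite subr_gt0|move=> k; rewrite subKr].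
have lt_tL k : aff (m k) x < tL by exact: le_lt_trans tLM.
have Gc := sumR_exp_term_continuous hmu.
have GP t : tL <= t -> has_sum (G x t) (sumR (G x t)).
  move=> tLt; have [mu mu0 h] := hmu; apply: sumRP (exp_term_bounded mu0 _) => k; have := h k; lra.
have GT : sumR (G x T) <= 1.
  have h : abs_bounded (G x T) 1.
    apply: abs_boundedW (half_exp_abs_bounded ler01) => // k.
    rewrite !ger0_norm ?expR_ge0 ?divr_ge0 ?exprn_ge0//; exact: lam_eps.
  exact: le_trans (ler_norm _) (has_sum_norm_le h (GP _ tLT)).
have GL : 1 <= sumR (G x tL).
  have h := has_sum_abs_bounded (fun k => expR_ge0 _) (GP _ (lexx _)).
  have := h [fset i; j]%fset; rewrite big_fsetU1 ?big_seq_fset1/=; last first.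
    by rewrite inE neq_ltn ltnSn.
  rewrite !ger0_norm ?expR_ge0// => hij; apply: le_trans hij.
  apply: (le_trans hs); apply: lerD; rewrite ler_expR.
    by rewrite -mulrN ler_wpM2l ?(ltW (lam0 i))// -/M; lra.
  by rewrite ler_wpM2l ?(ltW (lam0 j))//; lra.
have mT : Num.max T tL = T by apply/max_idPl.
have Gmid : Num.min (sumR (G x (Num.max tL tL))) (sumR (G x (Num.max T tL))) <= 1 <=
    Num.max (sumR (G x (Num.max tL tL))) (sumR (G x (Num.max T tL))).
  by rewrite mT maxxx ge_min GT orbT/= le_max GL.
have [t /itvP tI Gt] := IVT tLT (continuous_subspaceT Gc) Gmid.
have tLt : tL <= t by rewrite tI.
exists t; split.
- by have := GP t tLt; rewrite (max_l tLt) in Gt; rewrite Gt.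
- by move=> k; exact: lt_le_trans tLt.
- by rewrite (lt_trans xi (lt_le_trans tLM tLt))/= tI.
Qed.

Variable g : 'rV[R]_d -> R.
Hypothesis gP : forall x, U x ->
  [/\ has_sum (G x (g x)) 1, forall i, aff (m i) x < g x & c x < g x <= c x + eps x].

(** For late indices the tail bound holds on a whole ball around p, and evaluating it in the
    direction of steepest ascent bounds the slope times [rho]. The finitely many others are handled
    by taking [rho] small against the sum [S] of their slopes. *)
Lemma solution_margin p : U p -> exists2 rho : R, 0 < rho &
  forall i, aff (m i) p + rho * (\sum_j `|(m i).1 0 j| + 1) <= g p - rho.
Proof.
move=> Up; have [i [pi hi]] := max_attained Up.
set M := aff (m i) p in pi hi.
have [_ /(_ i) Mg _] := gP Up; rewrite -/M in Mg.
pose D := g p - M; have D0 : 0 < D by rewrite subr_gt0.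
have D40 : 0 < D / 4 by rewrite divr_gt0.
have [i0 hi0] := m_tail D40.
have [C [r [C0 r0 hC]]] := convex_usc Uo Uc cc Up.
pose n k := \sum_j `|(m k).1 0 j|.
have n0 k : 0 <= n k by exact: sumr_ge0.
pose S := \sum_(k < i0) n k.
have S0 : 0 <= S by exact: sumr_ge0.
pose rho := Num.min (Num.min r (D / 4 / (C + 1))) (Num.min (D / 4) (D / (S + 2))).
have rho0 : 0 < rho by rewrite !lt_min r0 D40 !divr_gt0// ltr_wpDl.
have rr : rho <= r by rewrite ge_min [X in X || _]ge_min lexx.
have rC : rho * (C + 1) <= D / 4.
  by rewrite -ler_pdivlMr ?ltr_wpDl// ge_min [X in X || _]ge_min lexx orbT.
have rD : rho <= D / 4 by rewrite ge_min [X in _ || X]ge_min lexx orbT.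
have rS : rho * (S + 2) <= D.
  by rewrite -ler_pdivlMr ?ltr_wpDl// ge_min [X in _ || X]ge_min lexx !orbT.
exists rho => // k; rewrite -/(n k).
have [ik|ki] := leqP i0 k.
  (* The extremal vector for the duality of sup norm and l^1 norm. *)
  pose u : 'rV[R]_d := \row_j (rho * Num.sg ((m k).1 0 j)).
  have dotu : dot (m k).1 u = rho * n k.
    rewrite /dot /n mulr_sumr; apply: eq_bigr => j _.
    by rewrite mxE mulrCA [in RHS]normrEsg [_ * Num.sg _]mulrC.
  have ur : `|u| <= rho.
    apply: rV_norm_le => [|j]; first exact: ltW.
    rewrite mxE normrM (gtr0_norm rho0) ler_piMr ?(ltW rho0)//.
    by rewrite normr_sg; case: (_ != 0).
  have [Upu cpu] : U (p + u) /\ c (p + u) <= c p + C * `|u|.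
    have := hC (p + u); rewrite addrC addKr => /(_ (le_trans ur rr)).
    by rewrite addrC.
  have := hi0 k ik _ Upu; rewrite affD dotu.
  have := ler_wpM2l C0 ur; move: pi cpu rC rD; rewrite /D; lra.
have nS : n k <= S by rewrite /S (bigD1 (Ordinal ki))//= lerDl sumr_ge0.
have := hi k; have := ler_wpM2l (ltW rho0) nS; move: rS; rewrite /D; lra.
Qed.

(** [solution_margin] is the summability needed to solve for a power series [t] centred at p;
    uniqueness of the root then identifies [g p + t u] with [g (p + u)]. *)
Lemma solution_analytic p : U p -> analytic_at g p.
Proof.
move=> Up; have [rho rho0 hrho] := solution_margin Up.
have [Gp _ _] := gP Up.
have [i0 _] := m_cst.
have EH : abs_bounded (fun i => G p (g p) i * expR (rho * (lam i * (\sum_j `|(m i).1 0 j| + 1))))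
    (expR (- rho) / (1 - expR (- rho))).
  pose z i := aff (m i) p + rho * (\sum_j `|(m i).1 0 j| + 1) - g p.
  have zr i : z i <= - rho by have := hrho i; rewrite /z; lra.
  rewrite (_ : (fun i => _) = fun i => expR (lam i * z i)).
    exact: expR_geometric_abs_bounded.
  by apply/funext => i; rewrite /exp_term -expRD; congr expR; rewrite /z; ring.
have [r [C [t [r0 tC ht]]]] := @implicit_pser R d (G p (g p)) lam
  (fun i => \sum_j `|(m i).1 0 j|) (fun i => dot (m i).1) rho _
  (fun i => expR_ge0 _) (fun i => ltW (lam0 i)) (fun i => sumr_ge0 _ (fun _ _ => normr_ge0 _))
  (fun i => dot_pser (m i).1) Gp (ex_intro _ i0 (mulr_gt0 (expR_gt0 _) (lam0 i0))) rho0 EH.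
have [r1 r10 hr1] := open_ball_rV Uo Up.
have r'0 : 0 < Num.min r (r1 / 2) by rewrite lt_min r0 divr_gt0.
exists (Num.min r (r1 / 2)), (`|g p| + C); split => //.
have t'C : pser (Num.min r (r1 / 2)) C t.
  by apply: pserW tC => //; rewrite (ltW r'0) ge_min lexx.
apply: eq_pser (pserD (pser_cst (g p) (ltW r'0)) t'C) => u.
rewrite le_min => /andP[ur ur1].
have Upu : U (p + u) by apply: hr1; rewrite addrC addKr; lra.
have [Gu _ _] := gP Upu; apply: (exp_term_root_unique (x := p + u)) Gu.
apply: eq_has_sum (ht u ur) => i.
by rewrite /exp_term -expRD affD; congr expR; ring.
Qed.

(** Otherwise all slopes along [v] vanish, as that of the constant member does, and every [m i] is
    constant on the line through p. Then [c] stays below M on this line, whose part in U lies in a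
    compact sublevel set; its last point in direction [v] belongs to the open set U, which is
    absurd. *)
Lemma slopes_differ p v : U p -> v != 0 -> exists i j, dot (m i).1 v != dot (m j).1 v.
Proof.
move=> Up v0; apply/not_existsP => H.
have [k mk] := m_cst; have {H}H i : dot (m i).1 v = 0.
  have -> : dot (m i).1 v = dot (m k).1 v; last by rewrite mk dot0l.
  by apply/eqP/negPn/negP => ij; apply: (H i); exists k.
have [i [pi hi]] := max_attained Up.
have [cU cK] := cP.
set M := aff (m i) p in pi hi.
have [aM Mb] : a0 <= M /\ (M%:E < b)%E.
  by split; [have [? _] := cU _ Up; exact/ltW/(le_lt_trans _ pi)|exact: m_lt].
have Kc := cK _ aM Mb.
set K := [set x | U x /\ a0 <= c x <= M] in Kc.
have line s : U (p + s *: v) -> K (p + s *: v).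
  move=> Us; split => //; have [-> _] := cU _ Us; rewrite /=.
  have [j cj] := m_above Us; apply: ltW; apply: (lt_le_trans cj).
  by rewrite affD dotZr H mulr0 addr0.
have [B [_ /(_ (B + 1)) ]] := compact_bounded Kc; rewrite ltrDl => /(_ ltr01) hB.
have nv : 0 < `|v| by rewrite normr_gt0.
pose S := [set s : R | U (p + s *: v)].
have Sbd s : S s -> s <= (`|p| + B + 1) / `|v|.
  move=> /line /hB /= h; rewrite ler_pdivlMr//.
  have h1 : s * `|v| <= `|s *: v| by rewrite normrZ ler_wpM2r// ler_norm.
  have h2 : `|s *: v| <= `|p + s *: v| + `|p|.
    by rewrite -{1}[s *: v](addKr p) addrC (le_trans (ler_normD _ _))// normrN.
  lra.
have supS : has_sup S.
  by split; [exists 0; rewrite /S/= scale0r addr0|exists ((`|p| + B + 1) / `|v|) => s /Sbd].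
have Kcl : closed K := compact_closed (@norm_hausdorff _ _) Kc.
have Ksup : K (p + sup S *: v).
  apply: Kcl => A /nbhs_ballP[e /= e0 eA].
  have e'0 : 0 < e / (`|v| + 1) by rewrite divr_gt0// ltr_wpDl.
  have [s Ss es] := sup_adherent e'0 supS.
  exists (p + s *: v); split; first exact: line.
  apply: eA; rewrite -ball_normE /= opprD addrACA subrr add0r -scalerBl normrZ.
  have ss : s <= sup S by apply: ub_le_sup => //; case: supS.
  rewrite ger0_norm ?subr_ge0//.
  have : sup S - s <= e / (`|v| + 1) by lra.
  rewrite ler_pdivlMr ?ltr_wpDl// => h.
  have [->|sS] := eqVneq (sup S) s; first by rewrite subrr mul0r.
  apply: lt_le_trans h; rewrite ltr_pM2l ?ltrDl// subr_gt0 lt_neqAle eq_sym sS; exact: ss.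
have [Usup _] := Ksup.
have [r r0 hr] := open_ball_rV Uo Usup.
have : S (sup S + r / 2 / `|v|).
  apply: hr; have -> : p + (sup S + r / 2 / `|v|) *: v - (p + sup S *: v) = (r / 2 / `|v|) *: v.
    by rewrite scalerDl addrA [_ + _ *: v]addrC addrK.
  rewrite normrZ ger0_norm ?divfK ?gt_eqF//; first lra.
  by rewrite !divr_ge0// ltW.
move=> /(ub_le_sup (proj2 supS)); rewrite gerDl leNgt !divr_gt0//.
Qed.

End approximant.

(** * Strict positivity of second derivatives *)

Section strict.
Context {R : realType} {d : nat}.
Variables (U : set 'rV[R]_d) (g : 'rV[R]_d -> R) (m : nat -> 'rV[R]_d * R) (lam : nat -> R).
Hypothesis Uo : open U.
Hypothesis lam0 : forall i, 0 < lam i.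
Hypothesis ga : forall x, U x -> analytic_at g x.
Hypothesis gsum : forall x, U x -> has_sum (exp_term m lam x (g x)) 1.
Hypothesis glam : forall x, U x -> exists C, abs_bounded (fun i => lam i * exp_term m lam x (g x) i) C.
Hypothesis gslope : forall x v, U x -> v != 0 -> exists i j, dot (m i).1 v != dot (m j).1 v.
Implicit Types (x y u v p : 'rV[R]_d).

(* Mean value theorem for s |-> g (p + s v). *)
Lemma nonpos_derive2_upper p v : U p -> 'D_v ('D_v g) p <= 0 -> exists h0 K : R, 0 < h0 /\
  forall h, `|h| <= h0 -> g (p + h *: v) <= g p + h * 'D_v g p + K * `|h| ^+ 3.
Proof.
move=> Up g2; have [[r r0 gd] ga1] := analytic_at_derive v (ga Up).
have [s [K [s0 HK]]] := analytic_at_taylor1 v ga1.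
pose h0 := Num.min s (r / (`|v| + 1)).
have v1 : 0 < `|v| + 1 by rewrite ltr_wpDl.
have h00 : 0 < h0 by rewrite lt_min s0 divr_gt0.
have K0 : 0 <= K.
  have := HK s; rewrite (gtr0_norm s0) => /(_ (lexx _)) /(le_trans (normr_ge0 _)).
  by rewrite pmulr_lge0// exprn_gt0.
exists h0, K; split => // h; rewrite le_min => /andP[hs hr].
have D (t : R) : `|t| <= `|h| -> is_derive t 1 (fun s : R => g (p + s *: v)) ('D_v g (p + t *: v)).
  move=> th; apply: is_derive_line; apply: gd.
  rewrite addrC addKr normrZ; apply: (@le_trans _ _ (`|h| * (`|v| + 1))).
    by apply: ler_pM => //; rewrite lerDl.
  by rewrite -ler_pdivlMr.
have E (t : R) : `|t| <= `|h| -> `|'D_v g (p + t *: v) - 'D_v g p - t * 'D_v ('D_v g) p| <= K * `|h| ^+ 2.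
  move=> th; apply: le_trans (HK t (le_trans th hs)) _.
  by rewrite ler_wpM2l// -(real_normK (num_real t)) lerXn2r ?nnegrE.
have cont a b : a <= b -> (forall t, t \in `[a, b] -> `|t| <= `|h|) ->
    {within `[a, b], continuous (fun s : R => g (p + s *: v))}.
  move=> ab' H; apply: derivable_within_continuous => t /H /D Dt; exact: ex_derive.
have [h_ge0|h_lt0] := leP 0 h.
  have ct : forall t, t \in `[0, h] -> `|t| <= `|h|.
    by move=> t /itvP tI; rewrite !ger0_norm ?tI.
  have [t tI] := MVT_segment h_ge0 (fun t tI => D t (ct t (subset_itv_oo_cc tI))) (cont _ _ h_ge0 ct).
  rewrite scale0r addr0 subr0 => gE; have := E t (ct t tI).
  move/itvP: tI => tI; have t0 : t * 'D_v ('D_v g) p <= 0 by rewrite mulr_ge0_le0// tI.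
  rewrite ler_norml => /andP[_ dE]; rewrite (ger0_norm h_ge0) in dE *.
  have dh : 'D_v g (p + t *: v) <= 'D_v g p + K * h ^+ 2 by lra.
  have := ler_wpM2r h_ge0 dh; rewrite exprS; lra.
have ct : forall t, t \in `[h, 0] -> `|t| <= `|h|.
  by move=> t /itvP tI; rewrite !ler0_norm ?tI ?(ltW h_lt0)// lerN2 tI.
have [t tI] := MVT_segment (ltW h_lt0) (fun t tI => D t (ct t (subset_itv_oo_cc tI))) (cont _ _ (ltW h_lt0) ct).
rewrite scale0r addr0 sub0r => gE; have := E t (ct t tI).
move/itvP: tI => tI; have t0 : 0 <= t * 'D_v ('D_v g) p by rewrite mulr_le0// tI.
rewrite ler_norml => /andP[dE _]; rewrite (ltr0_norm h_lt0) in dE *.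
have dh : 'D_v g p - K * (- h) ^+ 2 <= 'D_v g (p + t *: v) by lra.
have nh0 : 0 <= - h by rewrite oppr_ge0 ltW.
have := ler_wpM2r nh0 dh; rewrite [_ ^+ 3]exprS; lra.
Qed.

(* Adding the equations at p + h v and p - h v, each pair of terms exceeds
   twice the term at p up to O(h^3), and by a multiple of h^2 for an index whose
   slope along v differs from that of g. *)
Lemma derive2_gt0 p v : U p -> v != 0 -> 0 < 'D_v ('D_v g) p.
Proof.
move=> Up v0; rewrite ltNge; apply/negP => g2.
have [h0 [K [h00 HK]]] := nonpos_derive2_upper Up g2.
have [C hC] := glam Up.
have lamG := sumRP hC; set A := sumR _ in lamG.
(* The slope of [g] along [v] cannot equal two different slopes of the family. *)
have [j jg] : exists j, dot (m j).1 v - 'D_v g p != 0.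
  have [i [j ij]] := gslope Up v0.
  have [iE|] := eqVneq (dot (m i).1 v) ('D_v g p); last by exists i; rewrite subr_eq0.
  by exists j; rewrite subr_eq0 -iE eq_sym.
pose E i := exp_term m lam p (g p) i.
have E0 i : 0 < E i by exact: expR_gt0.
pose B i := dot (m i).1 v - 'D_v g p.
(* With y = lam j * h * B j, the gain [E j * (y / 2) ^+ 2] of the pair of terms j is twice
   [Y * h ^+ 2]; half of it survives the damping factor [q], which is at least 1/2. *)
pose Y := E j * (lam j * B j) ^+ 2 / 8.
have Y0 : 0 < Y.
  by rewrite divr_gt0// mulr_gt0// lt_neqAle sqr_ge0 andbT eq_sym sqrf_eq0 mulf_neq0// gt_eqF.
have [r r0 hr] := open_ball_rV Uo Up.
pose K1 := `|K| + 1; have K10 : 0 < K1 by rewrite ltr_wpDl.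
have KK1 : K <= K1 by rewrite /K1 (le_trans (ler_norm K))// lerDl.
have A0 : 0 <= A.
  by have := has_sum_abs_bounded (fun i => mulr_ge0 (ltW (lam0 i)) (expR_ge0 _)) lamG => /abs_bounded_ge0.
have v1 : 0 < `|v| + 1 by rewrite ltr_wpDl.
have r20 : 0 < r / 2 by rewrite divr_gt0.
have KA : 0 < 2 * K1 * A + 1 by rewrite ltr_wpDl// !mulr_ge0// ltW.
have lK : 0 < 2 * lam j * K1 by rewrite !mulr_gt0.
(* In turn the bounds on [h] give: validity of the cubic estimate, h^3 <= h, both points inside U,
   [lam j * de] at most 1/2, and a quadratic gain larger than the cubic loss. *)
have [|h hp hs] := @pos_lower_bound R [:: h0; 1; r / 2 / (`|v| + 1); 1 / (2 * lam j * K1); Y / (2 * K1 * A + 1)].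
  by rewrite /= h00 ltr01 (divr_gt0 r20 v1) (divr_gt0 ltr01 lK) (divr_gt0 Y0 KA).
have hh0 : h <= h0 by apply: hs; rewrite !inE eqxx.
have h1 : h <= 1 by apply: hs; rewrite !inE eqxx !orbT.
have hr' : h <= r / 2 / (`|v| + 1) by apply: hs; rewrite !inE eqxx !orbT.
have hl : h <= 1 / (2 * lam j * K1) by apply: hs; rewrite !inE eqxx !orbT.
have hY : h <= Y / (2 * K1 * A + 1) by apply: hs; rewrite !inE eqxx !orbT.
pose de := K1 * h ^+ 3.
have de0 : 0 < de by rewrite mulr_gt0// exprn_gt0.
have Uh (s : R) : `|s| = h -> U (p + s *: v).
  move=> sh; apply: hr; rewrite addrC addKr normrZ sh.
  apply: (@le_lt_trans _ _ (h * (`|v| + 1))); first by rewrite ler_wpM2l ?(ltW hp)// lerDl.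
  apply: (@le_lt_trans _ _ (r / 2)); last lra.
  by rewrite -ler_pdivlMr.
have nh : `|h| = h by rewrite gtr0_norm.
have nh' : `|- h| = h by rewrite normrN.
have lower (s : R) i : `|s| = h ->
    E i * expR (lam i * (s * B i) - lam i * de) <= exp_term m lam (p + s *: v) (g (p + s *: v)) i.
  move=> sh; rewrite /E /exp_term -expRD ler_expR -mulrBr -mulrDr ler_wpM2l ?(ltW (lam0 i))//.
  rewrite affD dotZr; have := HK s; rewrite sh => /(_ hh0).
  have := ler_wpM2r (exprn_ge0 3 (ltW hp)) KK1; rewrite /de /B; lra.
have deh : lam j * de <= 2^-1.
  apply: (@le_trans _ _ (lam j * (K1 * h))).
    rewrite ler_wpM2l ?(ltW (lam0 j))// ler_wpM2l ?(ltW K10)//.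
    by rewrite exprS ler_piMr ?(ltW hp)// exprn_ile1// ltW.
  have : h * (2 * lam j * K1) <= 1 by rewrite -ler_pdivlMr.
  lra.
pose w i := if i == j then Y * h ^+ 2 else 0.
have key i : 2 * E i - 2 * de * (lam i * E i) + w i <=
    exp_term m lam (p + h *: v) (g (p + h *: v)) i + exp_term m lam (p + - h *: v) (g (p + - h *: v)) i.
  apply: le_trans (lerD (lower _ i nh) (lower _ i nh')).
  rewrite -mulrDr !expRD -mulrDl mulNr mulrN.
  set y := lam i * (h * B i); set q := expR (- _).
  have q1 : 1 - lam i * de <= q by have := expR_ge1Dx (- (lam i * de)).
  have q0 : 0 <= q by exact: expR_ge0.
  have hc := cosh_ge y.
  apply: (@le_trans _ _ (E i * ((2 + (y / 2) ^+ 2) * q))); last first.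
    by rewrite ler_wpM2l ?(ltW (E0 i))// ler_wpM2r.
  have s0 : 0 <= (y / 2) ^+ 2 by rewrite sqr_ge0.
  rewrite /w; case: eqP => [ij|_]; last first.
    have h2 : 2 - 2 * (lam i * de) <= (2 + (y / 2) ^+ 2) * q by nra.
    have := ler_wpM2l (ltW (E0 i)) h2; lra.
  have q2 : 2^-1 <= q by move: deh; rewrite -ij; lra.
  have h2 : 2 - 2 * (lam i * de) + (y / 2) ^+ 2 / 2 <= (2 + (y / 2) ^+ 2) * q by nra.
  have := ler_wpM2l (ltW (E0 i)) h2.
  have -> : Y * h ^+ 2 = E i * ((y / 2) ^+ 2 / 2) by rewrite /Y /y ij; field.
  lra.
have S1 := has_sumD (gsum (Uh _ nh)) (gsum (Uh _ nh')).
have S2 := has_sumD (has_sumB (has_sumZ 2 (gsum Up)) (has_sumZ (2 * de) lamG)) (has_sum_single j (Y * h ^+ 2)).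
have := has_sum_le key S2 S1.
(* Both sides carry the total 2; cancelling it leaves the gain [Y * h ^+ 2] against the loss
   [2 * de * A], which is of order h^3. *)
rewrite mulr1; have : Y * h ^+ 2 <= 2 * de * A -> False.
  have : h * (2 * K1 * A + 1) <= Y by rewrite -ler_pdivlMr.
  have h20 : 0 < h ^+ 2 by rewrite exprn_gt0.
  move=> hy; apply/negP; rewrite -ltNge.
  have -> : 2 * de * A = h * (2 * K1 * A) * h ^+ 2 by rewrite /de; ring.
  by rewrite ltr_pM2r//; lra.
move=> H H1; apply: H; lra.
Qed.

Lemma solution_strongly_convex : strongly_convex U g.
Proof.
split; first exact: analytic_at_continuously_differentiable.
move=> x v t v0 Ut.
have -> : derive1n 2 (fun s : R => g (x + s *: v)) t = 'D_v ('D_v g) (x + t *: v).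
  rewrite /derive1n/= derive1E.
  have [[r r0 gd] ga1] := analytic_at_derive v (ga Ut).
  have [[r' r'0 gd'] _] := analytic_at_derive v ga1.
  have r'x : `|x + t *: v - (x + t *: v)| <= r' by rewrite subrr normr0 ltW.
  have D2 := is_derive_line (gd' _ r'x).
  (* The identity is needed on a neighbourhood of [t] because it is differentiated once more. *)
  have near_eq : \near t, 'D_v g (x + t *: v) = derive1 (fun s : R => g (x + s *: v)) t.
    near=> s; rewrite derive1E.
    have sr : `|x + s *: v - (x + t *: v)| <= r.
      rewrite opprD addrACA subrr add0r -scalerBl normrZ distrC.
      apply: (@le_trans _ _ (`|t - s| * (`|v| + 1))); first by rewrite ler_wpM2l// lerDl.
      rewrite -ler_pdivlMr ?ltr_wpDl//.
      near: s; apply: (@cvgr_dist_le _ _ _ _ _ id t); first exact: cvg_id.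
      by rewrite divr_gt0// ltr_wpDl.
    have D1 := is_derive_line (gd _ sr); by rewrite derive_val.
  have D3 := near_eq_is_derive near_eq D2.
  by rewrite derive_val.
exact: derive2_gt0.
Unshelve. all: by end_near. Qed.

End strict.

Theorem theorem5 (R : realType) (d : nat) (U : set 'rV[R]_d)
    (f : 'rV[R]_d -> R) :
  open U -> convex_set U -> properly_convex U f ->
  forall eps : 'rV[R]_d -> R,
    {within U, continuous eps} -> (forall x, U x -> 0 < eps x) ->
    exists g : 'rV[R]_d -> R,
      [/\ strongly_convex U g, real_analytic U g &
          forall x, U x -> `|f x - g x| <= eps x].
Proof.
move=> Uo Uc [l [c [a [b [ab cc cP fE]]]]] eps epsc eps0.
have [m [mabove mtail mgap mlt mcst]] := affine_family Uo Uc cc ab cP epsc eps0.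
have [lam [lamge lameps]] := exists_rates mgap.
have lam0 i : 0 < lam i by apply: lt_le_trans (lamge i); rewrite ltr0n.
have /choice[g gP] : forall x, exists t, U x -> [/\ has_sum (exp_term m lam x t) 1,
    forall i, aff (m i) x < t & c x < t <= c x + eps x].
  move=> x; have [Ux|] := pselect (U x); last by exists 0.
  by have [t tP] := exp_term_root mabove mtail mgap lamge lameps Ux; exists t.
(* Adding the linear part of [f] to every slope and to [g] alike leaves each [aff (m i) x - g x],
   and so the equation, unchanged; differences of slopes are unaffected too. *)
pose L := \row_j l (delta_mx 0 j).
pose g' x := dot L x + g x.
pose m' i := ((m i).1 + L, (m i).2).
have termE x : exp_term m' lam x (g' x) = exp_term m lam x (g x).
  by apply/funext => i; rewrite /exp_term /aff/= dotDl /g'; congr expR; ring.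
have ga x : U x -> analytic_at g' x.
  by move=> Ux; apply: analytic_at_dotD; exact: (solution_analytic Uo Uc cc mabove mtail mcst lamge gP Ux).
exists g'; split.
- apply: (@solution_strongly_convex _ _ _ _ m' lam) => //.
  + by move=> x Ux; rewrite termE; case: (gP x Ux).
  + move=> x Ux; rewrite termE.
    have [rho rho0 h] := solution_margin Uo Uc cc mabove mtail gP Ux.
    apply: (rate_exp_term_bounded lamge rho0) => i; apply: le_trans (h i).
    by rewrite lerDl mulr_ge0 ?(ltW rho0)// addr_ge0// sumr_ge0.
  + move=> x v Ux v0; have [i [j ij]] := slopes_differ Uo cP mabove mtail mlt mcst Ux v0.
    by exists i, j; rewrite !dotDl (inj_eq (addIr _)).
- exact: analytic_at_real_analytic.
- move=> x Ux; have [_ _ /andP[cg ge]] := gP x Ux.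
  rewrite fE// scalar_dot /g' -/L ler_norml; lra.
Qed.
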